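(* Let $n>1$ be an integer. The ai-semiring variety $\mathbf{Sr}(n,1)$ is hereditarily finitely based if and only if $n<4$.
   Context: An ai-semiring (additively idempotent semiring) is an algebra $(S,+,\cdot)$ of type $(2,2)$ such that $(S,+)$ is a commutative idempotent semigroup, $(S,\cdot)$ is a semigroup, and the identities $x(y+z)\approx xy+xz$ and $(y+z)x\approx yx+zx$ hold (no zero or unit element is part of the signature). For $n>1$, $\mathbf{Sr}(n,1)$ denotes the variety of all ai-semirings satisfying the identity $x^n\approx x$. A variety is finitely based if it can be defined by finitely many identities. A variety is hereditarily finitely based if all its subvarieties are finitely based. *)

(* Defs.v *)
From Stdlib Require Import List Arith.

Set Implicit Arguments.

(** Algebras of type (2,2), not assumed to satisfy any law.  As usual in
    universal algebra, the carrier is nonempty. *)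
Record algebra := Algebra {
  carrier :> Type;
  add : carrier -> carrier -> carrier;
  mul : carrier -> carrier -> carrier;
  carrier_inhabited : inhabited carrier }.

Arguments add {a} _ _.
Arguments mul {a} _ _.

Definition is_ai_semiring (S : algebra) : Prop :=
  (forall x y z : S, add (add x y) z = add x (add y z)) /\
  (forall x y : S, add x y = add y x) /\
  (forall x : S, add x x = x) /\
  (forall x y z : S, mul (mul x y) z = mul x (mul y z)) /\
  (forall x y z : S, mul x (add y z) = add (mul x y) (mul x z)) /\
  (forall x y z : S, mul (add y z) x = add (mul y x) (mul z x)).

Inductive term :=
  | Var (i : nat)
  | Add (s t : term)
  | Mul (s t : term).

(** [(s, t)] is the identity [s ≈ t]. *)
Definition identity : Type := term * term.

Fixpoint eval (S : algebra) (v : nat -> S) (t : term) : S :=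
  match t with
  | Var i => v i
  | Add s t => add (eval S v s) (eval S v t)
  | Mul s t => mul (eval S v s) (eval S v t)
  end.

Definition satisfies (S : algebra) (e : identity) : Prop :=
  forall v : nat -> S, eval S v (fst e) = eval S v (snd e).

(** [tpow t n] is [t^n] for [n >= 1]; there is no unit in the signature, and
    [tpow t 0] is the junk value [t]. *)
Definition tpow (t : term) (n : nat) : term :=
  Nat.iter (n - 1) (fun s => Mul s t) t.

Definition is_variety (V : algebra -> Prop) : Prop :=
  exists E : identity -> Prop,
    forall S : algebra, V S <-> (forall e, E e -> satisfies S e).

(** The identities range over the full type (2,2), so a finite basis also has
    to entail the ai-semiring laws. *)
Definition finitely_based (V : algebra -> Prop) : Prop :=
  exists l : list identity,
    forall S : algebra, V S <-> (forall e, In e l -> satisfies S e).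

Definition hereditarily_finitely_based (V : algebra -> Prop) : Prop :=
  forall W : algebra -> Prop,
    is_variety W -> (forall S : algebra, W S -> V S) -> finitely_based W.

(** The class Sr(n,1). *)
Definition Sr (n : nat) (S : algebra) : Prop :=
  is_ai_semiring S /\ satisfies S (tpow (Var 0) n, Var 0).

Definition Sr_basis (n : nat) : list identity :=
  let x := Var 0 in let y := Var 1 in let z := Var 2 in
  (Add (Add x y) z, Add x (Add y z)) ::
  (Add x y, Add y x) ::
  (Add x x, x) ::
  (Mul (Mul x y) z, Mul x (Mul y z)) ::
  (Mul x (Add y z), Add (Mul x y) (Mul x z)) ::
  (Mul (Add y z) x, Add (Mul y x) (Mul z x)) ::
  (tpow x n, x) :: nil.

Lemma Sr_finitely_based (n : nat) : finitely_based (Sr n).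
Proof.
exists (Sr_basis n); intros S; split.
- intros [(H1 & H2 & H3 & H4 & H5 & H6) H7] e He; simpl in He.
  destruct He as [<-|[<-|[<-|[<-|[<-|[<-|[<-|[]]]]]]]];
    try exact H7; intros v; simpl; auto.
- intros H.
  assert (Hk : forall k x y z, k < 7 ->
    let e := nth k (Sr_basis n) (Var 0, Var 0) in
    let v i := match i with 0 => x | 1 => y | _ => z end in
    eval S v (fst e) = eval S v (snd e)).
  { intros k x y z Hk e v; apply (H e), nth_In; exact Hk. }
  split; [repeat split|].
  + intros x y z; apply (Hk 0 x y z); repeat constructor.
  + intros x y; apply (Hk 1 x y x); repeat constructor.
  + intros x; apply (Hk 2 x x x); repeat constructor.
  + intros x y z; apply (Hk 3 x y z); repeat constructor.
  + intros x y z; apply (Hk 4 x y z); repeat constructor.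
  + intros x y z; apply (Hk 5 x y z); repeat constructor.
  + apply H; simpl; tauto.
Qed.

Lemma finitely_based_variety (V : algebra -> Prop) :
  finitely_based V -> is_variety V.
Proof. intros [l Hl]; exists (fun e => In e l); exact Hl. Qed.

Lemma Sr_variety (n : nat) : is_variety (Sr n).
Proof. apply finitely_based_variety, Sr_finitely_based. Qed.

(* Main.v *)
Require Import Defs.
From Stdlib Require Classical List.
From mathcomp Require all_boot all_algebra zify ring ssrAC.

(** Positive part. Since [Sr 2] is contained in [Sr 3], only [Sr 3] matters. In a
    member of [Sr 3], the set of words below a fixed element is closed under the
    rule [p a q, p b q, p c q => p a b c q]. This forces the multiplication to be a
    regular orthocryptogroup, so that the value of a word only depends on the order
    of first occurrences, the order of last occurrences and the parities of its
    letters. Hence a word [w] lies below a sum [t] as soon as, using only the words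
    of [t] written in the letters of [w], every letter can be reached in the right
    order from both sides, and the parity vector of [w] is a sum of an odd number of
    parity vectors.
    When [w <= t] holds in a subvariety but one of these conditions fails, collapsing
    the letters to at most four classes gives a consequence that restores the
    condition. So every subvariety is defined by identities in four variables, and
    up to equivalence there are finitely many of them.

    Negative part. For [n >= 4] some prime [p] divides both [n - 1] and
    [n (n - 1) / 2], so all class-2 groups built from a bilinear form over the field
    with [p] elements have exponent dividing [n - 1]. Identities of the flat
    extension of a group encode implications between group equations. In the groups
    [heis B] with [B] of size [r x N], the implication "[w_j] central with respect to
    [u], [t] for all [j], and [[u,t] [w_0,s_0] ... [w_(i-1),s_(i-1)] = 1], imply
    [[u,t] = 1]" holds for every [i] when [r < N], and fails for [i = N] when [B] is
    the identity; but every valuation of [r] variables in the latter group factors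
    through a group of the former kind. *)

(** * The exponents two and three *)

Module SmallExponent.

Import Classical all_boot zify.
Set Implicit Arguments. Unset Strict Implicit. Unset Printing Implicit Defensive.

(** * The law x^3 = x *)

Declare Scope ai_scope.
Delimit Scope ai_scope with ai.
Notation "x + y" := (Defs.add x y) : ai_scope.
Notation "x * y" := (Defs.mul x y) : ai_scope.
Notation "x <= y" := (Defs.add x y = y) : ai_scope.

Section CubeLaw.
Variable S : algebra.
Hypothesis SrS : Sr 3 S.
Local Open Scope ai_scope.
Implicit Types a b c d e f g p q s t x y z T : S.

Lemma saddA x y z : x + y + z = x + (y + z).
Proof. by case: SrS => -[H _] _; apply: H. Qed.
Lemma saddC x y : x + y = y + x.
Proof. by case: SrS => -[_ [H _]] _; apply: H. Qed.
Lemma saddx x : x + x = x.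
Proof. by case: SrS => -[_ [_ [H _]]] _; apply: H. Qed.
Lemma smulA x y z : x * y * z = x * (y * z).
Proof. by case: SrS => -[_ [_ [_ [H _]]]] _; apply: H. Qed.
Lemma smulDr x y z : x * (y + z) = x * y + x * z.
Proof. by case: SrS => -[_ [_ [_ [_ [H _]]]]] _; apply: H. Qed.
Lemma smulDl x y z : (y + z) * x = y * x + z * x.
Proof. by case: SrS => -[_ [_ [_ [_ [_ H]]]]] _; apply: H. Qed.
Lemma cube x : x * (x * x) = x.
Proof. by rewrite -smulA; case: SrS => _ /(_ (fun=> x)). Qed.
Lemma cubeK x r : x * (x * (x * r)) = x * r.
Proof. by rewrite -{4}(cube x) !smulA. Qed.

Lemma sle_trans y x z : x <= y -> y <= z -> x <= z.
Proof. by move=> h1 h2; rewrite -h2 -saddA h1. Qed.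
Lemma sle_anti x y : x <= y -> y <= x -> x = y.
Proof. by move=> h1 <-; rewrite saddC h1. Qed.
Lemma sle_addl x y : x <= x + y.
Proof. by rewrite -saddA saddx. Qed.
Lemma sle_addr x y : y <= x + y.
Proof. by rewrite saddC saddA saddx. Qed.
Lemma sadd_le x y z : x + y <= z <-> x <= z /\ y <= z.
Proof.
split=> [h|[h1 h2]]; last by rewrite saddA h2 h1.
by split; apply: (sle_trans _ h); [apply: sle_addl | apply: sle_addr].
Qed.
Lemma smul_lel x y z : x <= y -> z * x <= z * y.
Proof. by move=> h; rewrite -smulDr h. Qed.
Lemma smul_ler x y z : x <= y -> x * z <= y * z.
Proof. by move=> h; rewrite -smulDl h. Qed.
Lemma smul_le x y x' y' : x <= y -> x' <= y' -> x * x' <= y * y'.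
Proof. by move=> h h'; apply: (@sle_trans (y * x')); [apply: smul_ler|apply: smul_lel]. Qed.

(** The sum [s] of the three elements equals its own cube, and products are monotone in each
    factor. *)
Lemma triple_le a b c : a * (b * c) <= a + b + c.
Proof.
set s := a + b + c.
have ha : a <= s by rewrite /s saddA; apply: sle_addl.
have hb : b <= s by rewrite /s (saddC a) saddA; apply: sle_addl.
have hc : c <= s by apply: sle_addr.
by rewrite -(cube s); do 2?[apply: smul_le]; rewrite ?cube.
Qed.

Lemma triple_ctx p q a b c T :
  p * (a * q) <= T -> p * (b * q) <= T -> p * (c * q) <= T ->
  p * (a * (b * (c * q))) <= T.
Proof.
move=> ha hb hc; apply: (@sle_trans (p * ((a + b + c) * q))).
  by apply: smul_lel; rewrite -2!smulA; apply: smul_ler; rewrite smulA; apply: triple_le.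
by rewrite !smulDl !smulDr !sadd_le.
Qed.

Lemma triple_0 a b c T : a <= T -> b <= T -> c <= T -> a * (b * c) <= T.
Proof.
move=> ha hb hc; apply: (@sle_trans (a + b + c)); first exact: triple_le.
by rewrite !sadd_le.
Qed.

Definition idem e := e * e = e.
Lemma idemK e r : idem e -> e * (e * r) = e * r.
Proof. by move=> h; rewrite -smulA h. Qed.
Lemma idem_sq x : idem (x * x).
Proof. by rewrite /idem !smulA cubeK. Qed.

(** The triple rule in the context [e _ f], applied to [f], [e], [f], gives [(e f)^2 <= e f].
    Multiplying by [e f] and using the cube law gives the reverse inequality. *)
Lemma idemM e f : idem e -> idem f -> idem (e * f).
Proof.
move=> he hf; rewrite /idem !smulA; apply: sle_anti.
  have := @triple_ctx e f f e f (e * f); rewrite hf !(idemK _ he).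
  by apply; apply: saddx.
have: (e * (f * (e * f))) <= e * f.
  have := @triple_ctx e f f e f (e * f); rewrite hf !(idemK _ he).
  by apply; apply: saddx.
move/(smul_lel (e * f)); rewrite -smulA.
by have := cube (e * f); rewrite !smulA => ->.
Qed.

(** The triple rule gives [(e x)^2 <= e x^2]. Multiplying by [x] on the right and by [e x] on the
    left yields the two inequalities, each by a cube law. *)
Lemma idemM_sq e x : idem e -> e * (x * (e * (x * x))) = e * x.
Proof.
move=> he; have hx := idem_sq x.
have hex := idemM he hx; rewrite /idem !smulA in hex.
have hK r : e * (x * (x * (e * (x * (x * r))))) = e * (x * (x * r)).
  by have := congr1 (fun z => z * r) hex; rewrite !smulA.
have hle : e * (x * (e * x)) <= e * (x * x).
  have := @triple_ctx e x x (x * (x * (e * x))) x (e * (x * x)).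
  rewrite !smulA !cube hex cubeK; apply; exact: saddx.
apply: sle_anti.
  by have := smul_ler x hle; rewrite !smulA cube.
have := smul_lel (e * x) hle; rewrite !smulA.
by have := cube (e * x); rewrite !smulA => ->.
Qed.

End CubeLaw.

(** Reversing the multiplication transfers one-sided laws to the other side. *)
Definition opp_alg (S : algebra) : algebra :=
  @Algebra S (@Defs.add S) (fun x y => Defs.mul y x) (carrier_inhabited S).

Lemma opp_Sr3 (S : algebra) : Sr 3 S -> Sr 3 (opp_alg S).
Proof.
move=> SrS; split; last by move=> v; apply: (cube SrS).
case: (SrS) => -[h1 [h2 [h3 [h4 [h5 h6]]]]] _.
by do 5?split; move=> *; [exact: h1|exact: h2|exact: h3|rewrite /= h4|exact: h6|exact: h5].
Qed.

(** * Squares and idempotents: the laws of a regular orthocryptogroup *)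

Section Orthocryptogroup.
Variable S : algebra.
Hypothesis SrS : Sr 3 S.
Local Open Scope ai_scope.
Implicit Types a b c d e f g p q s t x y z T : S.
Let mA := smulA SrS.

Lemma idemM_sqr e x : idem e -> x * (x * (e * (x * e))) = x * e.
Proof.
move=> he; have := @idemM_sq (opp_alg S) (opp_Sr3 SrS) e x he.
by rewrite /= !mA.
Qed.

Lemma sq_idemM e x : idem e -> e * (x * (e * x)) = e * (x * x).
Proof.
move=> he; have := congr1 (fun z => z * x) (idemM_sq SrS x he).
by rewrite !mA cube.
Qed.

Lemma sq_Midem e x : idem e -> x * (e * (x * e)) = x * (x * e).
Proof.
move=> he; have := congr1 (fun z => x * z) (idemM_sqr x he).
by rewrite (cubeK SrS).
Qed.

(** By [gr], [x^2 y^2] is a right unit for [xy], so [(xy)^2] equals [(xy)^2 x^2 y^2]. By [gm],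
    [x^2 y^2] begins with [xy], so [(xy)^2] is a left unit for it and the same product equals
    [x^2 y^2]. *)
Lemma sqM x y : x * y * (x * y) = x * x * (y * y).
Proof.
have hx := idem_sq SrS x; have hy := idem_sq SrS y.
have K (u v w : S) : u * v = w -> forall r, u * (v * r) = w * r by move=> <- r; rewrite mA.
have e1 : x * (y * (y * (x * (y * y)))) = x * (x * (y * y)).
  by have := sq_Midem x hy; rewrite !mA.
have e2 : x * (x * (y * (x * (x * y)))) = x * (x * (y * y)).
  by have := sq_idemM y hx; rewrite !mA.
have e1' : x * (x * (y * (y * (x * (y * y))))) = x * (y * y).
  have := congr1 (fun z => z * (x * (y * y))) e1; rewrite !mA => <-.
  by have := cube SrS (x * (y * y)); rewrite !mA.
have e2' : x * (x * (y * (x * (x * (y * y))))) = x * (x * y).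
  have := cube SrS (x * (x * y)); rewrite !mA e2.
  by [].
have gl : x * (x * (y * (y * (x * y)))) = x * y.
  have := congr1 (fun z => z * y) e1'; rewrite !mA.
  by rewrite cube.
have gr : x * (y * (x * (x * (y * y)))) = x * y.
  have := congr1 (fun z => x * z) e2'; rewrite (cubeK SrS) => ->.
  by rewrite (cubeK SrS).
have xyyxy : x * (y * (y * (x * y))) = x * (x * y).
  have := congr1 (fun z => z * y) e1; rewrite !mA cube => //.
have gm : x * (y * (y * (x * (y * (x * (x * y)))))) = x * (x * (y * y)).
  have := congr1 (fun z => z * (x * (x * y))) xyyxy; rewrite !mA => ->.
  exact: e2.
have xy3 : x * (y * (x * (y * (x * y)))) = x * y by have := cube SrS (x * y); rewrite !mA.
rewrite !mA.
have h1 : x * (y * (x * (y * (x * (x * (y * y)))))) = x * (y * (x * y)).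
  by rewrite gr.
rewrite -h1.
have := congr1 (fun z => z * (y * (x * (x * y)))) xy3; rewrite !mA.
rewrite -gm.
by have := congr1 (fun z => z * (y * (x * (y * (x * (x * y)))))) xy3; rewrite !mA => ->.
Qed.

(** The idempotent [f = d s t d] absorbs [d] on both sides, while [E] writes [d] as a product
    containing [f]; together these force [f = d]. *)
Lemma idem_sandwich d s t : idem d -> idem s -> idem t ->
  d * (s * d) = d -> d * (t * d) = d -> d * (s * (t * d)) = d.
Proof.
move=> hd hs ht hsd htd.
have I2 e1 e2 : idem e1 -> idem e2 -> idem (e1 * e2) by apply: idemM.
have [f fE] : exists f, f = d * (s * (t * d)) by eexists.
have hf : idem f by rewrite fE; apply: (I2 _ _ hd (I2 _ _ hs (I2 _ _ ht hd))).
have df : d * f = f by rewrite fE (idemK SrS).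
have fd : f * d = f by rewrite fE !mA hd.
have E : d * (t * (f * (s * d))) = d.
  have h : idem (t * (d * s)) := I2 _ _ ht (I2 _ _ hd hs).
  transitivity (d * (t * (d * s) * (t * (d * s))) * d); first by rewrite fE !mA.
  by rewrite h !mA hsd htd.
rewrite -fE; clear fE.
have hv : idem (f * (s * f)) := I2 _ _ hf (I2 _ _ hs hf).
have Ef : f * (t * f) * (f * (s * f)) = f.
  have := congr1 (fun z => f * (z * f)) E; rewrite /= df hf !mA df. rewrite -(mA f d) fd.
  by rewrite (idemK SrS _ hf).
have fv : f * (s * f) = f.
  have := congr1 (fun z => z * (f * (s * f))) Ef; rewrite mA hv Ef => h.
  by rewrite [RHS]h (idemK SrS).
have tE : d * (t * f) = f.
  have := congr1 (fun z => z * f) E; rewrite !mA df => h.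
  by rewrite -[RHS]h fv.
have fsd : f * (s * d) = d by have := E; rewrite -(mA t) -(mA d) tE.
by rewrite -[in LHS]fd -{1}fsd (idemK SrS _ hf).
Qed.

(** This is the regular band law. The triple rule gives [c <= d]. Conversely it puts a product of
    three elements below [c], and this product reduces to [d x y d], which is [d] by
    [idem_sandwich]. *)
Lemma idem_insert e x y : idem e -> idem x -> idem y ->
  e * (x * (e * (y * e))) = e * (x * (y * e)).
Proof.
move=> he hx hy.
have I2 e1 e2 : idem e1 -> idem e2 -> idem (e1 * e2) by apply: idemM.
have K e1 e2 : idem e1 -> idem e2 -> e1 * (e2 * (e1 * e2)) = e1 * e2.
  by move=> h1 h2; rewrite -mA; apply: I2.
have KK e1 e2 r : idem e1 -> idem e2 -> e1 * (e2 * (e1 * (e2 * r))) = e1 * (e2 * r).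
  by move=> h1 h2; have := congr1 (fun z => z * r) (K _ _ h1 h2); rewrite !mA.
pose d := e * (x * (e * (y * e))); pose c := e * (x * (y * e)).
have hd : idem d by do 3?[apply: (I2 _ _ _ (I2 _ _ _ _)) => //]; apply: I2.
have hc : idem c by apply: (I2 _ _ he (I2 _ _ hx (I2 _ _ hy he))).
have c_le_d : c <= d.
  have := @triple_ctx S SrS (e * (x * e)) (e * (y * e)) x y y d.
  rewrite !mA !(idemK SrS _ hy) !KK // (K _ _ hy he) => h.
  by apply: h; rewrite /d; apply: saddx.
have X3 r : e * (x * (y * (e * (x * (y * r))))) = e * (x * (y * r)).
  by have := congr1 (fun z => z * r) (I2 _ _ he (I2 _ _ hx hy)); rewrite !mA.
have X4 r : e * (x * (e * (y * (e * (x * (e * (y * r))))))) = e * (x * (e * (y * r))).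
  by have := congr1 (fun z => z * r) (I2 _ _ (I2 _ _ he hx) (I2 _ _ he hy)); rewrite !mA.
have r_le : e * (x * (e * (y * c))) <= c.
  have := @triple_ctx S SrS (e * x) c e y y c.
  rewrite /c !mA !(idemK SrS _ hy) !(idemK SrS _ he) X3 KK // => h.
  by apply: h; apply: saddx.
have l_le : e * (x * (y * d)) <= c.
  have := @triple_ctx S SrS c (y * e) x e e c.
  rewrite /c /d !mA !(idemK SrS _ he) X3 K // => h.
  by apply: h; apply: saddx.
apply: (sle_anti SrS _ c_le_d).
have := triple_0 SrS r_le (saddx SrS c) l_le.
rewrite /c /d !mA !(idemK SrS _ he) !X3.
have := @idem_sandwich d x y hd hx hy.
rewrite /d !mA !KK // X4 => -> //.
Qed.

(** Both sides have the same square by [sqM] and [idem_insert], and the right side [c] lies below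
    the left side [d]. Squeezing gives [c d = c^2 = d^2], and the cube law turns this into
    [c = d]. *)
Lemma insert_idem e x y : idem e -> e * (x * (e * (y * e))) = e * (x * (y * e)).
Proof.
move=> he; have hx := idem_sq SrS x; have hy := idem_sq SrS y.
have exK r : e * (x * (e * (x * (x * r)))) = e * (x * r).
  by have := congr1 (fun z => z * r) (idemM_sq SrS x he); rewrite !mA.
have yeK : y * (y * (e * (y * e))) = y * e := idemM_sqr y he.
have sq : e * (x * (y * e)) * (e * (x * (y * e))) =
          e * (x * (e * (y * e))) * (e * (x * (e * (y * e)))).
  by rewrite !sqM he !mA; have := idem_insert he hx hy; rewrite !mA => ->.
have c_le_d : e * (x * (y * e)) <= e * (x * (e * (y * e))).
  have := @triple_ctx S SrS (e * (x * e)) (e * (y * e)) (x * x) (x * x) (y * y)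
            (e * (x * (e * (y * e)))).
  rewrite !mA !(cubeK SrS) !yeK !exK => h.
  by apply: h; apply: saddx.
move: sq c_le_d; move: (e * _) (e * _) => d c sq c_le_d.
have cd : c * d = c * c.
  by apply: (sle_anti SrS); [rewrite sq; apply: (smul_ler SrS) | apply: (smul_lel SrS)].
by rewrite -(cube SrS c) -(cube SrS d) -mA -sq mA cd.
Qed.

End Orthocryptogroup.

(** * Values of words *)

Notation word := (seq nat).

(** [undup] keeps the last occurrence of every letter, so it lists letters by last occurrence;
    conjugating with [rev] lists them by first occurrence. *)
Definition fo (w : word) : word := rev (undup (rev w)).

Definition same_parity (w w' : word) :=
  forall z, odd (count_mem z w) = odd (count_mem z w').

Definition similar (w w' : word) :=
  [/\ fo w = fo w', undup w = undup w' & same_parity w w'].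

Lemma fo_rcons w z : fo (rcons w z) = if z \in w then fo w else rcons (fo w) z.
Proof. by rewrite /fo rev_rcons /= mem_rev; case: ifP => // _; rewrite rev_cons. Qed.

Lemma mem_fo w : fo w =i w.
Proof. by move=> z; rewrite /fo mem_rev mem_undup mem_rev. Qed.

Lemma fo_uniq w : uniq (fo w).
Proof. by rewrite rev_uniq undup_uniq. Qed.

Lemma fo_cat w w' : fo (w ++ w') = fo w ++ [seq z <- fo w' | z \notin w].
Proof.
rewrite /fo rev_cat undup_cat rev_cat filter_rev; congr (_ ++ rev _).
by apply: eq_filter => z; rewrite mem_rev.
Qed.

Lemma fo_cat_sub w w' : {subset w' <= w} -> fo (w ++ w') = fo w.
Proof.
move=> h; rewrite fo_cat (_ : filter _ _ = [::]) ?cats0 //.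
apply/eqP; rewrite -(negbK (_ == _)) -has_filter; apply/hasPn => z.
by rewrite mem_fo negbK => /h.
Qed.

Lemma undup_cat_sub (w w' : word) : {subset w <= w'} -> undup (w ++ w') = undup w'.
Proof.
move=> h; rewrite undup_cat (_ : filter _ _ = [::]) //.
apply/eqP; rewrite -(negbK (_ == _)) -has_filter; apply/hasPn => z.
by rewrite mem_undup negbK => /h.
Qed.

Lemma fo_undup w : uniq w -> fo w = w.
Proof. by move=> h; rewrite /fo undup_id ?revK // rev_uniq. Qed.

Section Ev.
Variable S : algebra.
Variable v : nat -> S.
Local Open Scope ai_scope.

(** There is no unit, so the empty word gets the junk value [v 0]. *)
Fixpoint ev (w : word) : S :=
  match w with
  | [::] => v 0
  | z :: w' => if w' is [::] then v z else v z * ev w'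
  end.

Lemma ev_cons z w : w != [::] -> ev (z :: w) = v z * ev w.
Proof. by case: w. Qed.

Hypothesis SrS : Sr 3 S.

Lemma ev_cat w w' : w != [::] -> w' != [::] -> ev (w ++ w') = ev w * ev w'.
Proof.
elim: w => // z [|z' w] IH _ hw'; first by rewrite cat1s ev_cons.
rewrite cat_cons ev_cons; last by case: (w).
by rewrite IH // (ev_cons _ (w := z' :: w)) // smulA.
Qed.

Lemma cat_nil_neq (T : eqType) (a b : seq T) : (a ++ b != [::]) = (a != [::]) || (b != [::]).
Proof. by case: a. Qed.

Lemma ev_ctx p q a b : a != [::] -> b != [::] -> ev a = ev b ->
  ev (p ++ a ++ q) = ev (p ++ b ++ q).
Proof.
move=> ha hb hab; have h : ev (a ++ q) = ev (b ++ q).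
  by case: q => [|z q]; rewrite ?cats0 // !ev_cat // hab.
have [->|hp] := eqVneq p [::]; first exact: h.
by rewrite (ev_cat hp) ?cat_nil_neq ?ha // (ev_cat hp) ?cat_nil_neq ?hb // h.
Qed.

Lemma ev_idem_del a b c d z : idem (v z) ->
  ev (a ++ z :: b ++ z :: c ++ z :: d) = ev (a ++ z :: b ++ c ++ z :: d).
Proof.
move=> hz.
have h1 : ev (z :: b ++ z :: c ++ [:: z]) = ev (z :: b ++ c ++ [:: z]).
  case: b c => [|x b] [|y c].
  - by rewrite /= !hz.
  - have e1 : ev ([:: z] ++ [:: z] ++ (y :: c) ++ [:: z]) = ev ([:: z] ++ (y :: c) ++ [:: z]).
      by rewrite !ev_cat //= -[LHS](smulA SrS) hz.
    exact: e1.
  - have e1 : ev ([:: z] ++ (x :: b) ++ [:: z] ++ [:: z]) = ev ([:: z] ++ (x :: b) ++ [:: z]).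
      by rewrite !ev_cat //= hz.
    exact: e1.
  have e1 : ev ([:: z] ++ (x :: b) ++ [:: z] ++ (y :: c) ++ [:: z]) =
            ev ([:: z] ++ (x :: b) ++ (y :: c) ++ [:: z]).
    by rewrite !ev_cat //; apply: (insert_idem SrS).
  exact: e1.
have := @ev_ctx a d (z :: b ++ z :: c ++ [:: z]) (z :: b ++ c ++ [:: z]) isT isT h1.
by rewrite !cat_cons -!catA !cat_cons -!catA.
Qed.

Lemma ev_del_mid a d z : idem (v z) -> z \in a -> z \in d -> ev (a ++ z :: d) = ev (a ++ d).
Proof.
move=> hz /splitPr[a1 a2] /splitPr[d1 d2].
by rewrite -!catA !cat_cons ev_idem_del.
Qed.

End Ev.

Section Band.
Variable S : algebra.
Variable v : nat -> S.
Hypothesis SrS : Sr 3 S.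
Hypothesis idv : forall z, idem (v z).

Lemma ev_fo w u : {subset w <= u} -> ev v (w ++ u) = ev v (fo w ++ u).
Proof.
elim/last_ind: w u => // w z IH u h; rewrite fo_rcons cat_rcons.
have hw : {subset w <= u} by move=> y hy; apply: h; rewrite mem_rcons inE hy orbT.
have hz : z \in u by apply: h; rewrite mem_rcons inE eqxx.
case: ifP => hzw; first by rewrite ev_del_mid // IH.
by rewrite cat_rcons IH // => y /hw; rewrite inE orbC => ->.
Qed.

Lemma ev_undup w u : {subset w <= u} -> ev v (u ++ w) = ev v (u ++ undup w).
Proof.
elim: w u => // z w IH u h /=.
have hw : {subset w <= u} by move=> y hy; apply: h; rewrite inE hy orbT.
have hz : z \in u by apply: h; rewrite inE eqxx.
case: ifP => hzw; first by rewrite ev_del_mid // IH.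
by rewrite -!cat_rcons IH // => y /hw; rewrite mem_rcons inE orbC => ->.
Qed.

Lemma ev_idem w : w != [::] -> idem (ev v w).
Proof.
elim: w => // z [|z' w] IH _; first exact: idv.
by rewrite ev_cons //; apply: idemM => //; apply: IH.
Qed.

(** The value is idempotent, so the word may be doubled. Letters of the first copy recur in the
    second, so only first occurrences survive there; dually only last occurrences survive in the
    second copy. *)
Lemma ev_fo_undup w : w != [::] -> ev v w = ev v (fo w ++ undup w).
Proof.
move=> hw; rewrite -{1}(ev_idem hw) -ev_cat // ev_fo // ev_undup // => z.
by rewrite mem_fo.
Qed.

End Band.

(** * Both orders of occurrences and the parities determine the value of a word *)

Section Similar.
Variable S : algebra.
Variable v : nat -> S.
Hypothesis SrS : Sr 3 S.
Local Open Scope ai_scope.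
Let mA := smulA SrS.

Let sqv z := v z * v z.

Lemma ev_sq w : w != [::] -> ev sqv w = ev v w * ev v w.
Proof.
elim: w => // z [|z' w] IH _ //.
by rewrite ev_cons // (ev_cons v) // (IH isT) sqM.
Qed.

Lemma ev_sq_similar w w' : w != [::] -> w' != [::] -> fo w = fo w' ->
  undup w = undup w' -> ev v w * ev v w = ev v w' * ev v w'.
Proof.
move=> hw hw' hf hl; have idv z : idem (sqv z) by apply: idem_sq.
by rewrite -!ev_sq // (ev_fo_undup SrS idv hw) hf hl -ev_fo_undup.
Qed.

Section Group.
Variable g : S.
Hypothesis hg : idem g.
(** The elements with square [g] form a commutative group of exponent two with unit [g]. *)
Let G c := c * c = g.

Let Gl c : G c -> g * c = c.
Proof. by rewrite /G => <-; rewrite mA cube. Qed.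
Let Gr c : G c -> c * g = c.
Proof. by rewrite /G => <-; rewrite cube. Qed.
Let GM c d : G c -> G d -> G (c * d).
Proof. by rewrite /G => hc hd; rewrite sqM // hc hd. Qed.
Let GC c d : G c -> G d -> c * d = d * c.
Proof.
move=> hc hd; have h : c * d * (c * d) = g := GM hc hd.
have e1 : c * (c * d * (c * d)) * d = c * c * (d * c) * (d * d) by rewrite !mA.
by move: e1; rewrite h hc hd Gr // Gl ?Gr //; apply: GM.
Qed.

Let GCK c d e : G c -> G d -> d * (c * (d * e)) = c * e.
Proof. by move=> hc hd; rewrite -(mA c) (GC hc hd) -!mA (hd : d * d = g) Gl. Qed.

(** The product of the localised letters [g v(z) g]; [insert_idem] removes the inner copies of
    [g]. *)
Let Phi u := foldr (fun z acc => g * (v z * g) * acc) g u.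

Let PhiE u : u != [::] -> Phi u = g * (ev v u * g).
Proof.
elim: u => // z [|z' u] IH _; first by rewrite /= !mA hg.
transitivity (g * (v z * g) * Phi (z' :: u)); first by [].
rewrite IH // (ev_cons v z (w := z' :: u)) // !mA (idemK SrS _ hg).
exact: insert_idem.
Qed.

Variable A : pred nat.
Hypothesis hA : forall z, A z -> g * (v z * v z * g) = g.

Let Gphi z : A z -> G (g * (v z * g)).
Proof. by move=> hz; rewrite /G !sqM // hg hA. Qed.

Let PhiG u : all A u -> G (Phi u).
Proof. by elim: u => [_|z u IH /andP[hz hu]] //=; apply: GM; [apply: Gphi|apply: IH]. Qed.

Let Phi_cat a b : all A a -> all A b -> Phi (a ++ b) = Phi a * Phi b.
Proof.
elim: a => [_ hb|z a IH /andP[_ ha] hb] /=; first by rewrite Gl //; apply: PhiG.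
by rewrite IH // !mA.
Qed.

Let Phi_even u : all A u -> (forall z, ~~ odd (count_mem z u)) -> Phi u = g.
Proof.
have [n] := ubnP (size u); elim: n u => // n IH [|z u] //= hn /andP[hz hu] hev.
have hzu : z \in u.
  by have := hev z; rewrite eqxx /= negbK -has_pred1 has_count; case: (count _ _).
move: hu hn hev; case/splitPr: u / hzu => a b; rewrite all_cat /= => /and3P[ha _ hb] hn hev.
have hab : all A (a ++ b) by rewrite all_cat ha hb.
have -> : g * (v z * g) * Phi (a ++ z :: b) = Phi (a ++ b).
  rewrite !Phi_cat //=; last by rewrite hz hb.
  by apply: GCK; [apply: PhiG | apply: Gphi].
apply: IH => //.
  by move: hn; rewrite !size_cat /=; lia.
move=> y; have := hev y; rewrite !count_cat /=.
by case: (z == y); rewrite ?add0n // !addnS add1n /= negbK.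
Qed.

Lemma ev_group w w' : w != [::] -> w' != [::] -> all A w -> all A w' ->
  same_parity w w' -> g * (ev v w * g) = g * (ev v w' * g).
Proof.
move=> nw nw' hw hw' par; rewrite -!PhiE //.
have h : Phi w * Phi w' = g.
  rewrite -Phi_cat // Phi_even // ?all_cat ?hw //.
  by move=> z; rewrite count_cat oddD par addbb.
have := congr1 (fun x => x * Phi w') h.
by rewrite mA (PhiG hw') Gr ?Gl //; apply: PhiG.
Qed.

End Group.

(** The two words have the same square [g], and each value is unchanged by multiplying with [g] on
    both sides, so [ev_group] applies. *)
Lemma ev_similar w w' : w != [::] -> w' != [::] -> similar w w' -> ev v w = ev v w'.
Proof.
move=> nw nw' [hf hl par].
have hsq := ev_sq_similar nw nw' hf hl.
have mem : w =i w' by move=> z; rewrite -mem_undup hl mem_undup.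
pose g := ev v w * ev v w; have hg : idem g := idem_sq SrS _.
have w5 u : u != [::] -> ev v u * ev v u * (ev v u * (ev v u * ev v u)) = ev v u.
  by move=> nu; rewrite cube // mA cube.
rewrite -(w5 w) // -[RHS](w5 w') // -hsq.
apply: (@ev_group g hg (fun z => z \in w)) => //.
(* A letter of [w] put between two copies of [w] changes neither order of occurrences, so [g]
   absorbs its square. *)
- move=> z hz; have idv y : idem (sqv y) by apply: idem_sq.
  have E : ev sqv (w ++ [:: z] ++ w) = ev sqv w.
    have sz : {subset [:: z] <= w} by move=> y; rewrite inE => /eqP->.
    rewrite (ev_fo_undup SrS idv) ?cat_nil_neq ?nw //.
    rewrite [RHS](ev_fo_undup SrS idv) // fo_cat_sub; last first.
      by move=> y; rewrite mem_cat => /orP[/sz|].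
    by rewrite undup_cat_sub ?undup_cat_sub // => y hy; rewrite mem_cat hy orbT.
  by move: E; rewrite !ev_cat // (ev_sq nw).
- by apply/allP => z; rewrite -mem.
Qed.

End Similar.

(** The outer blocks fix the two orders and cancel in parity; the middle block supplies the
    parities. *)
Definition nform (w : word) : word :=
  fo w ++ [seq z <- undup w | odd (count_mem z w)] ++ undup w.

Lemma nform_similar w : similar w (nform w).
Proof.
split.
- rewrite /nform fo_cat_sub ?(fo_undup (fo_uniq w)) // => z.
  rewrite mem_cat mem_filter mem_undup mem_fo.
  by case/orP => // /andP[].
- rewrite /nform !undup_cat_sub ?(undup_id (undup_uniq w)) //.
    by move=> z; rewrite mem_filter mem_undup => /andP[].
  by move=> z; rewrite mem_fo mem_cat mem_filter !mem_undup orbC => ->.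
move=> z; rewrite /nform !count_cat count_filter (count_uniq_mem z (fo_uniq w)) (count_uniq_mem z (undup_uniq w)).
rewrite mem_fo mem_undup !oddD addbC -addbA addbb addbF.
set k := count _ (undup w).
have -> : k = ((z \in w) && odd (count_mem z w)).
  transitivity (count [pred y | (y == z) && odd (count_mem z w)] (undup w)).
    by apply: eq_count => y /=; case: eqP => // ->.
  case: (odd _); last by rewrite andbF (eq_count (a2 := pred0)) ?count_pred0 // => y /=; rewrite andbF.
  rewrite (eq_count (a2 := pred1 z)); last by move=> y /=; rewrite andbT.
  by rewrite count_uniq_mem ?undup_uniq // mem_undup andbT.
by rewrite -has_pred1 has_count; case: (count _ w) => [|n] //=; case: (odd n).
Qed.

(** * Sets of words closed under triple products in context *)

Lemma fo_rev w : fo (rev w) = rev (undup w).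
Proof. by rewrite /fo revK. Qed.
Lemma undup_rev w : undup (rev w) = rev (fo w).
Proof. by rewrite /fo revK. Qed.

Lemma same_parity_rev w w' : same_parity w w' -> same_parity (rev w) (rev w').
Proof. by move=> h z; rewrite !count_rev. Qed.

Lemma similar_rev w w' : similar w w' -> similar (rev w) (rev w').
Proof.
move=> [h1 h2 h3]; split; last exact: same_parity_rev.
  by rewrite !fo_rev h2.
by rewrite !undup_rev h1.
Qed.

(** The model is the set of nonempty words with value below a fixed element: [closed_sim] then comes
    from [ev_similar] and [closed_triple] from the cube law. *)
Record triple_closed (D : word -> Prop) : Prop := TripleClosed {
  closed_ne : forall s, D s -> s != [::];
  closed_sim : forall s s', s' != [::] -> similar s s' -> D s -> D s';
  closed_triple : forall p a b c q, a != [::] -> b != [::] -> c != [::] ->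
    D (p ++ a ++ q) -> D (p ++ b ++ q) -> D (p ++ c ++ q) ->
    D (p ++ a ++ b ++ c ++ q) }.

Definition rev_pred (D : word -> Prop) : word -> Prop := fun s => D (rev s).

Lemma rev_eq0 (s : word) : (rev s == [::]) = (s == [::]).
Proof. by rewrite -!size_eq0 size_rev. Qed.

Lemma closed_rev D : triple_closed D -> triple_closed (rev_pred D).
Proof.
move=> [h1 h2 h3]; rewrite /rev_pred; split.
- by move=> s /h1; rewrite rev_eq0.
- by move=> s s' hs' /similar_rev; apply: h2; rewrite rev_eq0.
move=> p a b c q ha hb hc; rewrite !rev_cat -!catA => ka kb kc.
by apply: h3; rewrite ?rev_eq0.
Qed.

(** * Letters licensed from the left and from the right, and the membership criterion *)

Section Good.
Variable D : word -> Prop.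

(* [lgood C P g]: reading [g] from the left after the letters of [P], every new
   letter is licensed by a member of [D] with letters in [C] in which it is
   preceded by letters already read only. *)
Definition lgood (C P g : word) :=
  forall g1 y g2, g = g1 ++ y :: g2 -> y \notin P ++ g1 ->
  exists h1 h2, [/\ D (h1 ++ y :: h2), {subset h1 <= P ++ g1} & {subset h2 <= C}].

Lemma lgood_cat C P a b : lgood C P a -> lgood C (P ++ a) b -> lgood C P (a ++ b).
Proof.
move=> ha hb g1 y g2 e hy; have := congr1 size e; rewrite !size_cat /= => hs.
have [hle|hlt] := leqP (size a) (size g1).
  have e1 : g1 = a ++ drop (size a) g1.
    have := congr1 (take (size a)) e; rewrite take_size_cat // takel_cat // => e2.
    by rewrite {1}e2 cat_take_drop.
  move: e hy; rewrite e1 -catA => /eqP; rewrite eqseq_cat // eqxx /= => /eqP e.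
  by rewrite catA => hy; have := hb _ _ _ e hy.
apply: (ha g1 y (take (size a - (size g1).+1) g2)) => //.
have := congr1 (take (size a)) e; rewrite take_size_cat // => e2.
rewrite {1}e2 take_cat ltnNge ltnW //=; congr (_ ++ _).
by have -> : size a - size g1 = (size a - (size g1).+1).+1 by lia.
Qed.

Lemma lgood_mono C P P' g : {subset P <= P'} -> lgood C P g -> lgood C P' g.
Proof.
move=> hP h g1 y g2 e hy.
have hs : {subset P ++ g1 <= P' ++ g1}.
  by move=> z; rewrite !mem_cat => /orP[/hP->|->]; rewrite ?orbT.
have [|h1 [h2 [k1 k2 k3]]] := h g1 y g2 e; first by apply: contra hy => /hs.
by exists h1, h2; split=> // z /k2 /hs.
Qed.

Lemma lgood_sub C P g : {subset g <= P} -> lgood C P g.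
Proof.
move=> h g1 y g2 e; rewrite mem_cat h // e mem_cat inE eqxx orbT //.
Qed.

Lemma lgood_D C P h : D h -> {subset h <= C} -> lgood C P h.
Proof.
move=> hD hC g1 y g2 e _; exists g1, g2; split; rewrite -?e //.
  by move=> z hz; rewrite mem_cat hz orbT.
by move=> z hz; apply: hC; rewrite e mem_cat inE hz !orbT.
Qed.

Lemma lgood_catl C P a b : lgood C P (a ++ b) -> lgood C P a.
Proof. by move=> h g1 y g2 e; apply: (h g1 y (g2 ++ b)); rewrite e -catA. Qed.

Lemma lgood_catr C P a b : lgood C P (a ++ b) -> lgood C (P ++ a) b.
Proof. by move=> h g1 y g2 e; rewrite -catA; apply: (h _ y g2); rewrite e -catA. Qed.

Lemma lgood_flatten C P L : (forall s, s \in L -> D s) ->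
  {subset flatten L <= C} -> lgood C P (flatten L).
Proof.
elim: L P => [|s L IH] P hD hC; first exact: lgood_sub.
apply: lgood_cat.
  apply: lgood_D; first by apply: hD; rewrite inE eqxx.
  by move=> z hz; apply: hC; rewrite /= mem_cat hz.
apply: IH => [s' hs'|z hz]; first by apply: hD; rewrite inE hs' orbT.
by apply: hC; rewrite /= mem_cat hz orbT.
Qed.

End Good.

(** The mirror image of [lgood]. [P] and [C] matter only as sets of letters, so they are not
    reversed. *)
Definition rgood D (C P g : word) := lgood (rev_pred D) C P (rev g).

Section RGood.
Variable D : word -> Prop.

Lemma rgood_cat C P a b : rgood D C P b -> rgood D C (b ++ P) a -> rgood D C P (a ++ b).
Proof.
move=> hb ha; rewrite /rgood rev_cat; apply: lgood_cat => //.
by apply: lgood_mono ha => z; rewrite !mem_cat mem_rev orbC.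
Qed.

Lemma rgood_mono C P P' g : {subset P <= P'} -> rgood D C P g -> rgood D C P' g.
Proof. exact: lgood_mono. Qed.

Lemma rgood_sub C P g : {subset g <= P} -> rgood D C P g.
Proof. by move=> h; apply: lgood_sub => z; rewrite mem_rev => /h. Qed.

Lemma rgood_D C P h : D h -> {subset h <= C} -> rgood D C P h.
Proof.
move=> hD hC; apply: lgood_D => [|z]; first by rewrite /rev_pred revK.
by rewrite mem_rev => /hC.
Qed.

Lemma rgood_catr C P a b : rgood D C P (a ++ b) -> rgood D C P b.
Proof. by rewrite /rgood rev_cat; apply: lgood_catl. Qed.

Lemma rgood_flatten C P L : (forall s, s \in L -> D s) ->
  {subset flatten L <= C} -> rgood D C P (flatten L).
Proof.
elim: L P => [|s L IH] P hD hC; first exact: rgood_sub.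
apply: rgood_cat.
  apply: IH => [s' hs'|z hz]; first by apply: hD; rewrite inE hs' orbT.
  by apply: hC; rewrite /= mem_cat hz orbT.
apply: rgood_D; first by apply: hD; rewrite inE eqxx.
by move=> z hz; apply: hC; rewrite /= mem_cat hz.
Qed.

End RGood.

Section Criterion.
Variable D : word -> Prop.
Hypothesis cD : triple_closed D.

Lemma closed3 a b c : D a -> D b -> D c -> D (a ++ b ++ c).
Proof.
move=> ha hb hc; have := @closed_triple _ cD [::] a b c [::].
by rewrite /= !cats0; apply=> //; apply: closed_ne cD _ _.
Qed.

Lemma closed_flatten H : odd (size H) -> (forall s, s \in H -> D s) -> D (flatten H).
Proof.
have [n] := ubnP (size H); elim: n H => // n IH [|a [|b H]] //= hn ho hH.
  by rewrite cats0; apply: hH; rewrite inE eqxx.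
have hD s : s \in H -> D s by move=> hs; apply: hH; rewrite !inE hs !orbT.
apply: closed3; [apply: hH|apply: hH|apply: IH] => //; rewrite ?inE ?eqxx ?orbT //.
  exact: ltnW hn.
by move: ho; rewrite negbK.
Qed.

(** Starting from [u], members [a ++ r] of [D] are built in which [a] has the first occurrences of
    longer and longer prefixes of [g]. *)
Lemma lgood_build g u : D u -> {subset u <= g} -> lgood D g [::] g ->
  exists2 G, D G & {subset G <= g} /\ fo G = fo g.
Proof.
move=> hu ug hg.
suff: exists a r, [/\ fo a = fo g, D (a ++ r) & {subset a ++ r <= g}].
  move=> [a [r [h1 h2 h3]]]; exists (a ++ r) => //; split=> //.
  rewrite fo_cat_sub // => z hz; rewrite -mem_fo h1 mem_fo.
  by apply: h3; rewrite mem_cat hz orbT.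
suff: forall g1 g2, g = g1 ++ g2 ->
  exists a r, [/\ fo a = fo g1, D (a ++ r) & {subset a ++ r <= g}].
  by move=> h; apply: (h g [::]); rewrite cats0.
elim/last_ind => [|g1 y IH] g2 eg; first by exists [::], u.
have [a [r [h1 h2 h3]]] : exists a r, [/\ fo a = fo g1, D (a ++ r) & {subset a ++ r <= g}].
  by apply: (IH (y :: g2)); rewrite eg cat_rcons.
rewrite fo_rcons; case: ifP => hy; first by exists a, r.
have [] := hg g1 y g2; rewrite ?eg ?cat_rcons ?hy //.
rewrite -cat_rcons -eg => k1 [k2 [d1 d2 d3]].
have hyg : y \in g by rewrite eg mem_cat mem_rcons inE eqxx.
have h1g z : z \in k1 -> z \in g by move/d2 => /= hz; rewrite eg mem_cat mem_rcons inE hz orbT.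
have [a0|na] := eqVneq a [::].
  have g10 : g1 = [::].
    by apply/eqP; rewrite -size_eq0; move: h1; rewrite a0; case: (g1) => // z s /esym/eqP;
      rewrite -size_eq0 size_rev size_eq0 => /eqP e; have := mem_undup (rev (z :: s)) z; rewrite e mem_rev inE eqxx.
  have k10 : k1 = [::] by rewrite g10 in d2; case: (k1) d2 => // z s /(_ z); rewrite inE eqxx => /(_ isT).
  exists [:: y], k2; split; first by rewrite g10.
    by move: d1; rewrite k10.
  by move=> z; rewrite inE => /orP[/eqP->|/d3].
(* The triple rule with empty left context and right context [r], applied to [a], [(k1 y k2)(a r) a]
   and [a], brings the licence of [y] directly behind [a]. *)
exists (a ++ k1 ++ [:: y]), (k2 ++ (a ++ r) ++ a ++ a ++ r); split.
- rewrite catA cats1 fo_rcons fo_cat_sub => [|z /d2]; last by rewrite /= -mem_fo -h1 mem_fo.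
  rewrite mem_cat -(mem_fo a) h1 mem_fo hy /= ifN //.
  by apply: contraFN hy => /d2.
- have h4 : D ((k1 ++ y :: k2) ++ (a ++ r) ++ a ++ r) := closed3 d1 h2 h2.
  have nb : (k1 ++ y :: k2) ++ (a ++ r) ++ a != [::] by case: (k1).
  have E : (k1 ++ y :: k2) ++ (a ++ r) ++ a ++ r =
           [::] ++ ((k1 ++ y :: k2) ++ (a ++ r) ++ a) ++ r by rewrite /= !catA.
  rewrite {}E in h4.
  have h5 := closed_triple cD (p := [::]) na nb na h2 h4 h2.
  by move: h5; rewrite /= -?catA /= -?catA.
move=> z; rewrite !mem_cat inE -!orbA.
have ha : z \in a -> z \in g by move=> hz; apply: h3; rewrite mem_cat hz.
have hr : z \in r -> z \in g by move=> hz; apply: h3; rewrite mem_cat hz orbT.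
by case/or4P => [/ha|/h1g|/eqP->|/or3P[/d3|/ha|/or4P[/hr|/ha|/ha|/hr]]].
Qed.

End Criterion.

Lemma rgood_build D g u : triple_closed D -> D u -> {subset u <= g} -> rgood D g [::] g ->
  exists2 G, D G & {subset G <= g} /\ undup G = undup g.
Proof.
move=> cD hu ug hg.
have [|||G hG [h1 h2]] := @lgood_build _ (closed_rev cD) (rev g) (rev u).
- by rewrite /rev_pred revK.
- by move=> z; rewrite !mem_rev => /ug.
- by move=> g1 y g2 e hy; have [k1 [k2 [? ? h]]] := hg g1 y g2 e hy;
    exists k1, k2; split=> // z; rewrite mem_rev => /h.
exists (rev G) => //; split=> [z|]; first by rewrite mem_rev => /h1; rewrite mem_rev.
by rewrite undup_rev h2 fo_rev revK.
Qed.

(** The product of [G1 G1], the words of [H] and [G2 G2] has an odd number of factors. It takes its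
    first occurrences from [G1], its last ones from [G2] and its parities from [H], so it is similar
    to [g]. *)
Lemma closed_assemble D g G1 G2 H : triple_closed D -> g != [::] ->
  D G1 -> {subset G1 <= g} -> fo G1 = fo g ->
  D G2 -> {subset G2 <= g} -> undup G2 = undup g ->
  odd (size H) -> (forall s, s \in H -> D s /\ {subset s <= g}) ->
  same_parity (flatten H) g -> D g.
Proof.
move=> cD ng D1 s1 f1 D2 s2 f2 ho hH hp.
have mg1 z : z \in g -> z \in G1 by rewrite -mem_fo -f1 mem_fo.
have mg2 z : z \in g -> z \in G2 by rewrite -mem_undup -f2 mem_undup.
have DG : D (flatten ([:: G1; G1] ++ H ++ [:: G2; G2])).
  apply: closed_flatten => //; first by rewrite !size_cat !oddD ho.
  by move=> s; rewrite !mem_cat !inE => /or3P[/orP[]/eqP->|/hH[]|/orP[]/eqP->].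
apply: (closed_sim cD _ _ DG) => //.
have sH : {subset flatten H <= g}.
  by move=> z /flattenP[s hs hz]; have [_] := hH s hs; apply.
rewrite !flatten_cat /= !cats0; split.
- rewrite -f1 -catA fo_cat_sub // => z; rewrite !mem_cat.
  by case/or4P=> [//|/sH/mg1|/s2/mg1|/s2/mg1].
- rewrite -f2 !catA undup_cat_sub // => z; rewrite !mem_cat -!orbA.
  by case/or4P=> [/s1/mg2|/s1/mg2|/sH/mg2|].
by move=> z; rewrite !count_cat !oddD hp !addbb addFb addbF.
Qed.

Lemma criterion D g H : triple_closed D -> g != [::] -> lgood D g [::] g -> rgood D g [::] g ->
  odd (size H) -> (forall s, s \in H -> D s /\ {subset s <= g}) ->
  same_parity (flatten H) g -> D g.
Proof.
move=> cD ng hl hr ho hH hp.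
have [u uH] : exists u, u \in H by case: (H) ho => // u s _; exists u; rewrite inE eqxx.
have [Du ug] := hH u uH.
have [G1 D1 [s1 f1]] := lgood_build cD Du ug hl.
have [G2 D2 [s2 f2]] := rgood_build cD Du ug hr.
exact: closed_assemble D1 s1 f1 D2 s2 f2 ho hH hp.
Qed.

(** * Parity vectors and substitutions *)

Lemma odd_count_addb (T : Type) (a b : pred T) l :
  odd (count (fun z => a z (+) b z) l) = odd (count a l) (+) odd (count b l).
Proof.
elim: l => //= z l IH; rewrite !oddD !oddb IH.
by case: (a z); case: (b z); case: (odd _); case: (odd _).
Qed.

(** Duality over the field with two elements, with [odd (count a _)] as linear functional. If the
    functional found for [L] does not vanish on the new word [l], the search is repeated for
    [v + l], and a sum of both functionals may be taken. *)
Lemma parity_sep (L : seq word) (v : word) :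
  (exists2 H : seq word, {subset H <= L} & same_parity (flatten H) v) \/
  (exists2 a : pred nat, forall l, l \in L -> ~~ odd (count a l) & odd (count a v)).
Proof.
elim: L v => [|l L IH] v.
  case: (boolP (has (fun z => odd (count_mem z v)) v)) => [/hasP[z _ hz]|/hasPn h].
    by right; exists (pred1 z).
  left; exists [::] => // z; case: (boolP (z \in v)) => [/h/negbTE->|hz] //.
  by rewrite (count_memPn hz).
case: (IH v) => [[H sH pH]|[a ha hv]].
  by left; exists H => // z /sH hz; rewrite inE hz orbT.
case: (boolP (odd (count a l))) => hl; last first.
  by right; exists a => // z; rewrite inE => /orP[/eqP->|/ha].
case: (IH (v ++ l)) => [[H sH pH]|[b hb hvb]].
  left; exists (l :: H).
    by move=> z; rewrite !inE => /orP[->|/sH->] //; rewrite orbT.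
  by move=> z; rewrite /= count_cat oddD pH count_cat oddD addbC -addbA addbb addbF.
rewrite count_cat oddD in hvb.
case: (boolP (odd (count b l))) => hlb; rewrite ?hlb ?(negbTE hlb) ?addbF ?addbT in hvb; last first.
  by right; exists b => // z; rewrite inE => /orP[/eqP->|/hb].
right; exists (fun z => a z (+) b z).
  move=> z; rewrite inE odd_count_addb => /orP[/eqP->|hz]; first by rewrite hl hlb.
  by rewrite (negbTE (ha _ hz)) (negbTE (hb _ hz)).
by rewrite odd_count_addb hv (negbTE hvb).
Qed.

(* An affine version is obtained by recording the length of [H] in an extra letter. *)
Lemma parity_sep_affine (L : seq word) (v : word) :
  (exists H : seq word, [/\ {subset H <= L}, odd (size H) & same_parity (flatten H) v]) \/
  (exists (a : pred nat) (e : bool),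
     (forall l, l \in L -> odd (count a l) = e) /\ odd (count a v) <> e).
Proof.
pose ext (l : word) := 0 :: map S l.
have cnt0 (l : word) : count_mem 0 (map S l) = 0.
  by rewrite count_map (eq_count (a2 := pred0)) ?count_pred0.
have cntS z (l : word) : count_mem z.+1 (map S l) = count_mem z l.
  by rewrite count_map; apply: eq_count => y /=; rewrite eqSS.
case: (parity_sep (map ext L) (ext v)) => [[H sH pH]|[a ha hv]]; [left|right].
  have [K eK sK] : exists2 K, H = map ext K & {subset K <= L}.
    elim: H sH {pH} => [|h H IH] sH; first by exists [::].
    have [|K eK sK] := IH; first by move=> z hz; apply: sH; rewrite inE hz orbT.
    have /mapP[l hl el] : h \in map ext L by apply: sH; rewrite inE eqxx.
    exists (l :: K); first by rewrite /= -eK -el.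
    by move=> z; rewrite inE => /orP[/eqP->|/sK].
  have c0 : count_mem 0 (flatten (map ext K)) = size K.
    by elim: (K) => //= l K' IH; rewrite count_cat IH cnt0.
  have cS z : count_mem z.+1 (flatten (map ext K)) = count_mem z (flatten K).
    by elim: (K) => //= l K' IH; rewrite !count_cat IH cntS.
  exists K; split=> // [|z].
    by have := pH 0; rewrite eK c0 => ->; rewrite /= cnt0.
  by have := pH z.+1; rewrite eK cS => ->; rewrite /= cntS.
exists (fun z => a z.+1), (a 0); split.
  move=> l hl; have := ha (ext l) (map_f _ hl).
  by rewrite /= count_map oddD; case: (a 0) => //=; case: odd.
move: hv; rewrite /= count_map oddD => hv e; move: hv; rewrite /preim /= e.
by case: (a 0).
Qed.

Definition subst (tau : nat -> word) (s : word) : word := flatten (map tau s).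

Lemma subst_cat tau a b : subst tau (a ++ b) = subst tau a ++ subst tau b.
Proof. by rewrite /subst map_cat flatten_cat. Qed.

Lemma mem_subst tau s y z : y \in s -> z \in tau y -> z \in subst tau s.
Proof. by move=> hy hz; apply/flatten_mapP; exists y. Qed.

Lemma subst_sub tau (s C : word) : (forall y, y \in s -> {subset tau y <= C}) -> {subset subst tau s <= C}.
Proof. by move=> h z /flatten_mapP[y /h]; apply. Qed.

Lemma subst_even tau s : (forall y, y \in s -> same_parity (tau y) [::]) ->
  same_parity (subst tau s) [::].
Proof.
move=> h; elim: s h => // y s IH h z; rewrite /= count_cat oddD h ?inE ?eqxx //.
by rewrite IH // => x hx; apply: h; rewrite inE hx orbT.
Qed.

Lemma same_parity_double a : same_parity (a ++ a) [::].
Proof. by move=> z; rewrite count_cat oddD addbb. Qed.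

Lemma rev_subst tau s : rev (subst tau s) = subst (fun z => rev (tau z)) (rev s).
Proof.
elim: s => // y s IH; rewrite rev_cons -cats1 subst_cat -IH.
by rewrite -[subst _ [:: y]]/(rev (tau y) ++ [::]) cats0 -rev_cat.
Qed.

Lemma lgood_subst D C P tau s :
  (forall s1 y s2, s = s1 ++ y :: s2 -> lgood D C (P ++ subst tau s1) (tau y)) ->
  lgood D C P (subst tau s).
Proof.
elim: s P => [|y s IH] P h; first exact: lgood_sub.
apply: lgood_cat; first by have := h [::] y s erefl; rewrite cats0.
by apply: IH => s1 z s2 e; rewrite -catA; apply: (h (y :: s1) z s2); rewrite e.
Qed.

Lemma rgood_subst D C P tau s :
  (forall s1 y s2, s = s1 ++ y :: s2 -> rgood D C (subst tau s2 ++ P) (tau y)) ->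
  rgood D C P (subst tau s).
Proof.
elim: s => [|y s IH] h; first exact: rgood_sub.
apply: rgood_cat; last by have := h [::] y s erefl.
by apply: IH => s1 z s2 e; apply: (h (y :: s1) z s2); rewrite e.
Qed.

Lemma lgood1 (D : word -> Prop) C P h1 y h2 : D (h1 ++ y :: h2) -> {subset h1 <= P} ->
  {subset h2 <= C} -> lgood D C P [:: y].
Proof.
move=> hD s1 s2 [|z [|//]] z' g2 // [<- _] _; exists h1, h2; split=> //.
by move=> x /s1; rewrite cats0.
Qed.

Lemma rgood1 (D : word -> Prop) C P h1 y h2 : D (h2 ++ y :: h1) -> {subset h1 <= P} ->
  {subset h2 <= C} -> rgood D C P [:: y].
Proof.
move=> hD s1 s2; apply: (@lgood1 _ _ _ (rev h1) y (rev h2)).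
- by rewrite /rev_pred rev_cat rev_cons !revK cat_rcons.
- by move=> z; rewrite mem_rev => /s1.
by move=> z; rewrite mem_rev => /s2.
Qed.

(** The frame offers the letters of [u] on both sides of [X], and its last two copies of [u] cancel
    in parity. *)
Lemma sandwich D u X H : triple_closed D -> D u ->
  lgood D (u ++ X ++ u ++ u) u X -> rgood D (u ++ X ++ u ++ u) u X ->
  odd (size H) -> (forall s, s \in H -> D s /\ {subset s <= u ++ X ++ u ++ u}) ->
  same_parity (flatten H) (u ++ X) -> D (u ++ X ++ u ++ u).
Proof.
set G := u ++ _ => cD hu hl hr ho hH hp.
have uG : {subset u <= G} by move=> z hz; rewrite /G mem_cat hz.
have nG : G != [::] by rewrite /G cat_nil_neq (closed_ne cD hu).
apply: (criterion cD nG _ _ ho hH).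
- apply: lgood_cat; first exact: lgood_D.
  apply: lgood_cat => //; apply: lgood_sub => z.
  by rewrite !mem_cat orbb => ->.
- apply: rgood_cat; last by apply: rgood_sub => z hz; rewrite !mem_cat hz !orbT.
  apply: rgood_cat; last by apply: rgood_mono hr => z hz; rewrite !mem_cat hz.
  apply: rgood_cat; first exact: rgood_D.
  by apply: rgood_sub => z hz; rewrite mem_cat hz.
by move=> z; rewrite hp /G !count_cat !oddD addbb addbF.
Qed.

(** * Instances of an inequality in four variables *)

(* [f], [b1] and [b2] encode a substitution of words for letters that takes at most
   four values. *)
Record rule_system (D : word -> Prop) (t : seq word) (w : word) : Prop := RuleSystem {
  rs_closed : triple_closed D;
  rs_gen : forall s, s \in t -> D s;
  rs_t : t != [::];
  rs_w : w != [::];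
  rs_rule : forall (b1 b2 : pred nat) (f : bool -> bool -> word) p q,
    (forall x y, f x y != [::]) ->
    let tau z := f (b1 z) (b2 z) in
    (forall s, s \in t -> D (p ++ subst tau s ++ q)) -> D (p ++ subst tau w ++ q) }.

Lemma rule_system_rev D t w : rule_system D t w ->
  rule_system (rev_pred D) (map rev t) (rev w).
Proof.
move=> [cD gen ht hw rule]; split.
- exact: closed_rev.
- by move=> s /mapP[s' hs ->]; rewrite /rev_pred revK; apply: gen.
- by rewrite -size_eq0 size_map size_eq0.
- by rewrite rev_eq0.
move=> b1 b2 f p q hf tau hD; rewrite /rev_pred !rev_cat rev_subst revK -catA.
apply: (rule b1 b2 (fun x y => rev (f x y))) => [x y|s hs]; first by rewrite rev_eq0.
have := hD (rev s) (map_f _ hs).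
by rewrite /rev_pred !rev_cat rev_subst revK -catA.
Qed.

(** * A member of [D] with exactly the letters of [w] *)

Lemma last_outside (u l : word) : ~~ all (mem u) l ->
  exists k1 y k2, [/\ l = k1 ++ y :: k2, y \notin u & {subset k2 <= u}].
Proof.
elim: l => //= z l IH.
case: (boolP (all (mem u) l)) => h; last first.
  move=> _; have [k1 [y [k2 [-> h1 h2]]]] := IH h.
  by exists (z :: k1), y, k2.
rewrite andbT => hz; exists [::], z, l; split=> //.
by move=> x; apply: (allP h).
Qed.

Section Rules.
Variables (D : word -> Prop) (t : seq word) (w : word).
Hypothesis rs : rule_system D t w.
Let cD := rs_closed rs.
Let T := flatten t.

Let TTne : T ++ T != [::].
Proof.
rewrite cat_nil_neq orbb /T; have := rs_t rs; have := rs_gen rs.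
case: (t) => // s t' h _; have := closed_ne cD (h s (mem_head _ _)).
by rewrite /= cat_nil_neq => ->.
Qed.

Let sub_T s z : s \in t -> z \in s -> z \in T.
Proof. by move=> hs hz; apply/flattenP; exists s. Qed.

Let T_lgood C P : {subset T <= C} -> lgood D C P (T ++ T).
Proof.
move=> h; apply: lgood_cat; first by apply: lgood_flatten => //; apply: rs_gen rs.
by apply: lgood_sub => z hz; rewrite mem_cat hz orbT.
Qed.

Let T_rgood C P : {subset T <= C} -> rgood D C P (T ++ T).
Proof.
move=> h; apply: rgood_cat; first by apply: rgood_flatten => //; apply: rs_gen rs.
by apply: rgood_sub => z hz; rewrite mem_cat hz.
Qed.

Section Content.
Variable u : word.
Hypothesis (Du : D u) (uw : {subset u <= w}).
Hypothesis hu : forall s, s \in t -> {subset s <= w} -> {subset s <= u}.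
Let une := closed_ne cD Du.

Let ctau (b : pred nat) (Y : word) y :=
  if y \in w then if b y then Y ++ Y else u ++ u else T ++ T.

(** A summand inside [w] has its letters in [u], so its image is a power of [u]. Any other summand
    has a letter with image [T T], which allows all words of [t] as licences. All images are
    doubled, so only the frame contributes parity. *)
Lemma content_rule (b : pred nat) (Y : word) : Y != [::] ->
  (forall y, b y -> y \in w -> y \notin u) ->
  (forall s1 y s2 C P, s1 ++ y :: s2 \in t -> y \in w -> b y -> {subset T <= C} ->
     {subset u <= P} -> (~~ all (mem w) s1 -> {subset T <= P}) -> lgood D C P Y) ->
  (forall s1 y s2 C P, s1 ++ y :: s2 \in t -> y \in w -> b y -> {subset T <= C} ->
     {subset u <= P} -> (~~ all (mem w) s2 -> {subset T <= P}) -> rgood D C P Y) ->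
  D (u ++ subst (ctau b Y) w ++ u ++ u).
Proof.
move=> nY hb hl hr; set tau := ctau b Y.
pose f (x y : bool) := if x then if y then Y ++ Y else u ++ u else T ++ T.
have := rs_rule rs (b1 := mem w) (b2 := b) (f := f) (p := u) (q := u ++ u).
apply=> [[] []|s hs]; rewrite ?cat_nil_neq ?nY ?une ?orbT //; first by have := TTne; rewrite cat_nil_neq.
  by have := TTne; rewrite cat_nil_neq.
change (D (u ++ subst tau s ++ u ++ u)).
set G := u ++ subst tau s ++ u ++ u.
have out y : y \in s -> y \notin w -> {subset T <= subst tau s}.
  by move=> hy hyw z hz; apply: mem_subst hy _; rewrite /tau /ctau (negbTE hyw) mem_cat hz.
have TG : ~~ all (mem w) s -> {subset T <= G}.
  case/allPn => y hy hyw z hz; rewrite /G 2!mem_cat.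
  by rewrite (out y hy hyw z hz) orbT.
have nall y : y \in s -> y \in w -> b y -> ~~ all (mem w) s.
  move=> hy hyw hby; apply/negP => /allP h.
  by have := hb y hby hyw; rewrite (hu hs h hy).
apply: (@sandwich D u (subst tau s) [:: u]) => //; rewrite -/G.
- apply: lgood_subst => s1 y s2 e.
  have hys : y \in s by rewrite e mem_cat mem_head orbT.
  rewrite /tau /ctau; case: ifP => hyw; last first.
    by apply: T_lgood; apply: TG; apply/allPn; exists y => //=; rewrite hyw.
  case: ifP => hby; last by apply: lgood_sub => z; rewrite !mem_cat orbb => ->.
  have gY : lgood D G (u ++ subst tau s1) Y.
    apply: (hl s1 y s2) => //; first by rewrite -e.
    - by apply: TG; apply: nall hys hyw hby.
    - by move=> z hz; rewrite mem_cat hz.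
    case/allPn => x hx hxw z hz; rewrite mem_cat; apply/orP; right.
    by apply: mem_subst hx _; rewrite /tau /ctau (negbTE (hxw : x \notin w)) mem_cat hz.
  by apply: lgood_cat => //; apply: lgood_sub => z hz; rewrite mem_cat hz orbT.
- apply: rgood_subst => s1 y s2 e.
  have hys : y \in s by rewrite e mem_cat mem_head orbT.
  rewrite /tau /ctau; case: ifP => hyw; last first.
    by apply: T_rgood; apply: TG; apply/allPn; exists y => //=; rewrite hyw.
  case: ifP => hby; last by apply: rgood_sub => z; rewrite !mem_cat orbb => ->; rewrite orbT.
  have gY : rgood D G (subst tau s2 ++ u) Y.
    apply: (hr s1 y s2) => //; first by rewrite -e.
    - by apply: TG; apply: nall hys hyw hby.
    - by move=> z hz; rewrite mem_cat hz orbT.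
    case/allPn => x hx hxw z hz; rewrite mem_cat; apply/orP; left.
    by apply: mem_subst hx _; rewrite /tau /ctau (negbTE (hxw : x \notin w)) mem_cat hz.
  by apply: rgood_cat => //; apply: rgood_sub => z hz; rewrite mem_cat hz.
- move=> x; rewrite inE => /eqP->; split=> // z hz; rewrite /G mem_cat hz //.
move=> z; rewrite /= cats0 count_cat oddD subst_even ?addbF // => y _.
by rewrite /tau /ctau; case: ifP => _; [case: ifP => _|]; apply: same_parity_double.
Qed.

Lemma content_sub (b : pred nat) (Y : word) :
  {subset Y <= w} -> {subset u ++ subst (ctau b Y) w ++ u ++ u <= w}.
Proof.
move=> Yw z; rewrite !mem_cat orbb => /or3P[/uw| |/uw] //.
apply: subst_sub z => y hy z; rewrite /ctau hy.
by case: ifP => _; rewrite mem_cat orbb; [apply: Yw|apply: uw].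
Qed.

(* In the instance that replaces [x] by [y], the new letter is licensed from the right
   by [s2], and from the left because [x] is always preceded by a letter outside [w],
   whose image contains all letters of [t]. *)
Lemma content_one_sided x s1 y s2 :
  x \in w -> x \notin u ->
  (forall s1 s2, s1 ++ x :: s2 \in t -> ~~ all (mem w) s1) ->
  s1 ++ y :: s2 \in t -> {subset s2 <= u} -> y \in w ->
  exists u', [/\ D u', {subset u' <= w}, {subset u <= u'} & y \in u'].
Proof.
move=> xw xu hx hs s2u yw.
have yT : y \in T by apply: sub_T hs _; rewrite mem_cat mem_head orbT.
exists (u ++ subst (ctau (pred1 x) [:: y]) w ++ u ++ u); split; first apply: content_rule => //.
- by move=> z /eqP->.
- move=> r1 z r2 C P hr zw /eqP ez TC uP TP; rewrite ez in hr.
  by apply: lgood_sub => c; rewrite inE => /eqP->; apply: (TP (hx _ _ hr)).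
- move=> r1 z r2 C P hr zw /eqP ez TC uP TP.
  apply: (@rgood1 _ _ _ s2 y s1); first exact: rs_gen rs _ hs.
    by move=> c /s2u/uP.
  by move=> c hc; apply: TC; apply: sub_T hs _; rewrite mem_cat hc.
- by apply: content_sub => c; rewrite inE => /eqP->.
- by move=> c hc; rewrite mem_cat hc.
rewrite mem_cat; apply/orP; right; rewrite mem_cat; apply/orP; left.
by apply: (mem_subst xw); rewrite /ctau xw /= eqxx mem_head.
Qed.

Lemma content_two_sided x : x \in w -> x \notin u ->
  (forall s1 s2, s1 ++ x :: s2 \in t -> ~~ all (mem w) s1) ->
  (forall s1 s2, s1 ++ x :: s2 \in t -> ~~ all (mem w) s2) ->
  exists u', [/\ D u', {subset u' <= w}, {subset u <= u'} & x \in u'].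
Proof.
move=> xw xu hl hr.
exists (u ++ subst (ctau (pred1 x) [:: x]) w ++ u ++ u); split; first apply: content_rule => //.
- by move=> z /eqP->.
- move=> r1 z r2 C P hs zw /eqP ez TC uP TP; rewrite ez in hs.
  apply: lgood_sub => c; rewrite inE => /eqP->; apply: (TP (hl _ _ hs)).
  by apply: sub_T hs _; rewrite mem_cat mem_head orbT.
- move=> r1 z r2 C P hs zw /eqP ez TC uP TP; rewrite ez in hs.
  apply: rgood_sub => c; rewrite inE => /eqP->; apply: (TP (hr _ _ hs)).
  by apply: sub_T hs _; rewrite mem_cat mem_head orbT.
- by apply: content_sub => c; rewrite inE => /eqP->.
- by move=> c hc; rewrite mem_cat hc.
rewrite mem_cat; apply/orP; right; rewrite mem_cat; apply/orP; left.
by apply: (mem_subst xw); rewrite /ctau xw /= eqxx mem_head.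
Qed.

(** [A] joins prefixes of summands ending in the missing letters, and [B] joins suffixes beginning
    with them. [A] is licensed from the left, [B] from the right, and each contains all missing
    letters, so [A ++ B] is licensed from both sides. *)
Lemma content_both x0 : x0 \in w -> x0 \notin u ->
  (forall x, x \in w -> x \notin u ->
    (exists s1 s2, s1 ++ x :: s2 \in t /\ {subset s1 <= w}) /\
    (exists s1 s2, s1 ++ x :: s2 \in t /\ {subset s2 <= w})) ->
  exists u', [/\ D u', {subset u' <= w}, {subset u <= u'} & x0 \in u'].
Proof.
move=> xw xu hM.
have [A [Aw Agood Aall]] : exists A, [/\ {subset A <= w},
    (forall C P, {subset T <= C} -> lgood D C P A) &
    (forall x, x \in w -> x \notin u -> x \in A)].
  suff: forall l : word, {subset l <= w} -> exists A, [/\ {subset A <= w},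
    (forall C P, {subset T <= C} -> lgood D C P A) &
    (forall x, x \in l -> x \notin u -> x \in A)] by move/(_ w); apply.
  elim=> [|x l IH] lw; first by exists [::]; split=> // C P _; apply: lgood_sub.
  have [|A [Aw Agood Aall]] := IH; first by move=> z hz; apply: lw; rewrite inE hz orbT.
  have [hx|hx] := boolP (x \in u).
    by exists A; split=> // z; rewrite inE => /orP[/eqP->|/Aall] //; rewrite hx.
  have [[s1 [s2 [hs s1w]]] _] := hM x (lw _ (mem_head _ _)) hx.
  exists (rcons s1 x ++ A); split.
  - move=> z; rewrite mem_cat mem_rcons inE => /orP[/orP[/eqP->|/s1w]|/Aw] //.
    exact: lw (mem_head _ _).
  - move=> C P TC; apply: lgood_cat; last exact: Agood.
    apply: (@lgood_catl _ _ _ _ s2); rewrite cat_rcons.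
    by apply: lgood_D; [apply: rs_gen rs _ hs|move=> z /(sub_T hs)/TC].
  move=> z; rewrite inE mem_cat mem_rcons inE => /orP[->//|hz hzu].
  by rewrite Aall ?orbT.
have [B [Bw Bgood Ball]] : exists B, [/\ {subset B <= w},
    (forall C P, {subset T <= C} -> rgood D C P B) &
    (forall x, x \in w -> x \notin u -> x \in B)].
  suff: forall l : word, {subset l <= w} -> exists B, [/\ {subset B <= w},
    (forall C P, {subset T <= C} -> rgood D C P B) &
    (forall x, x \in l -> x \notin u -> x \in B)] by move/(_ w); apply.
  elim=> [|x l IH] lw; first by exists [::]; split=> // C P _; apply: rgood_sub.
  have [|B [Bw Bgood Ball]] := IH; first by move=> z hz; apply: lw; rewrite inE hz orbT.
  have [hx|hx] := boolP (x \in u).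
    by exists B; split=> // z; rewrite inE => /orP[/eqP->|/Ball] //; rewrite hx.
  have [_ [s1 [s2 [hs s2w]]]] := hM x (lw _ (mem_head _ _)) hx.
  exists (B ++ x :: s2); split.
  - move=> z; rewrite mem_cat inE => /or3P[/Bw|/eqP->|/s2w] //.
    exact: lw (mem_head _ _).
  - move=> C P TC; apply: rgood_cat; last exact: Bgood.
    apply: (@rgood_catr _ _ _ s1).
    by apply: rgood_D; [apply: rs_gen rs _ hs|move=> z /(sub_T hs)/TC].
  move=> z; rewrite inE mem_cat inE => /orP[->|hz hzu]; first by rewrite orbT.
  by rewrite Ball.
have hY : {subset A ++ B <= w} by move=> z; rewrite mem_cat => /orP[/Aw|/Bw].
have xY : x0 \in A ++ B by rewrite mem_cat Aall.
have YA P z : {subset u <= P} -> z \in A ++ B -> z \in P ++ A.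
  move=> uP; rewrite !mem_cat => /orP[->|/Bw zw]; first by rewrite orbT.
  by have [/uP->|/(Aall z zw)->] := boolP (z \in u); rewrite ?orbT.
have YB P z : {subset u <= P} -> z \in A ++ B -> z \in B ++ P.
  move=> uP; rewrite !mem_cat => /orP[/Aw zw|->//].
  by have [/uP->|/(Ball z zw)->] := boolP (z \in u); rewrite ?orbT.
exists (u ++ subst (ctau (fun z => z \notin u) (A ++ B)) w ++ u ++ u).
split; first apply: content_rule => //.
- by case: (A ++ B) xY.
- move=> r1 z r2 C P _ _ _ TC uP _; apply: lgood_cat; first exact: Agood.
  by apply: lgood_sub => c hc; apply: YA => //; rewrite mem_cat hc orbT.
- move=> r1 z r2 C P _ _ _ TC uP _; apply: rgood_cat; first exact: Bgood.
  by apply: rgood_sub => c hc; apply: YB => //; rewrite mem_cat hc.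
- exact: content_sub.
- by move=> c hc; rewrite mem_cat hc.
rewrite mem_cat; apply/orP; right; rewrite mem_cat; apply/orP; left.
by apply: (mem_subst xw); rewrite /ctau xw xu mem_cat xY.
Qed.

End Content.

End Rules.

(** [content_one_sided] wants a suffix with letters in [u], so [y0] gives way to the last letter
    outside [u] from [y0] on. *)
Lemma content_left D t w u x0 y0 : rule_system D t w -> D u -> {subset u <= w} ->
  (forall s, s \in t -> {subset s <= w} -> {subset s <= u}) ->
  x0 \in w -> x0 \notin u ->
  (forall s1 s2, s1 ++ x0 :: s2 \in t -> ~~ all (mem w) s1) ->
  (exists s1 s2, s1 ++ y0 :: s2 \in t /\ {subset s2 <= w}) -> y0 \in w -> y0 \notin u ->
  exists u' y, [/\ D u', {subset u' <= w}, {subset u <= u'}, y \in u' & y \in w /\ y \notin u].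
Proof.
move=> rs Du uw hu xw xu hx [s1 [s2 [hs s2w]]] yw yu.
have [|k1 [y [k2 [e hy k2u]]]] := @last_outside u (y0 :: s2); first by rewrite /= (negbTE yu).
have yw' : y \in w.
  have : y \in y0 :: s2 by rewrite e mem_cat mem_head orbT.
  by rewrite inE => /orP[/eqP->|/s2w].
rewrite e catA in hs.
have [u' [h1 h2 h3 h4]] := content_one_sided rs Du uw hu xw xu hx hs k2u yw'.
by exists u', y.
Qed.

(** If some missing [x] never follows a prefix inside [w], then either a missing letter precedes a
    suffix inside [w] and [content_left] applies, or [x] falls under [content_two_sided]. The dual
    case is reversed, and [content_both] covers the rest. *)
Lemma content_step D t w u x0 : rule_system D t w -> D u -> {subset u <= w} ->
  (forall s, s \in t -> {subset s <= w} -> {subset s <= u}) ->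
  x0 \in w -> x0 \notin u ->
  exists u' y, [/\ D u', {subset u' <= w}, {subset u <= u'}, y \in u' & y \in w /\ y \notin u].
Proof.
move=> rs Du uw hu xw xu.
pose inA x := exists s1 s2, s1 ++ x :: s2 \in t /\ {subset s1 <= w}.
pose inB x := exists s1 s2, s1 ++ x :: s2 \in t /\ {subset s2 <= w}.
have hA x : ~ inA x -> forall s1 s2, s1 ++ x :: s2 \in t -> ~~ all (mem w) s1.
  by move=> h s1 s2 hs; apply/negP => /allP s1w; apply: h; exists s1, s2.
have hB x : ~ inB x -> forall s1 s2, s1 ++ x :: s2 \in t -> ~~ all (mem w) s2.
  by move=> h s1 s2 hs; apply/negP => /allP s2w; apply: h; exists s1, s2.
have two x : x \in w -> x \notin u -> ~ inA x -> ~ inB x -> exists u' y,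
    [/\ D u', {subset u' <= w}, {subset u <= u'}, y \in u' & y \in w /\ y \notin u].
  move=> xw' xu' /hA ha /hB hb.
  by have [u' [? ? ? ?]] := content_two_sided rs Du uw hu xw' xu' ha hb; exists u', x.
have [hall|] := classic (forall x, x \in w -> x \notin u -> inA x /\ inB x).
  by have [u' [? ? ? ?]] := content_both rs Du uw hu xw xu hall; exists u', x0.
move=> /not_all_ex_not[x h].
have [xw' {}h] := imply_to_and _ _ h; have [xu' {}h] := imply_to_and _ _ h.
have [na|nb] := not_and_or _ _ h; clear h.
  have [[y [yw yu yB]]|none] := classic (exists y, [/\ y \in w, y \notin u & inB y]).
    exact: content_left rs Du uw hu xw' xu' (hA _ na) yB yw yu.
  by apply: (two x) => // hb; apply: none; exists x.
have [[y [yw yu [s1 [s2 [hs s1w]]]]]|none] :=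
    classic (exists y, [/\ y \in w, y \notin u & inA y]).
  have [|||||||||u' [y' [h1 h2 h3 h4 [h5 h6]]]] :=
    @content_left _ _ _ (rev u) x y (rule_system_rev rs).
  - by rewrite /rev_pred revK.
  - by move=> z; rewrite !mem_rev => /uw.
  - move=> s /mapP[s' hs' ->] h z; rewrite !mem_rev.
    by apply: hu => // c; rewrite -mem_rev => /h; rewrite mem_rev.
  - by rewrite mem_rev.
  - by rewrite mem_rev.
  - move=> r1 r2 /mapP[s' hs' e].
    have es' : s' = rev r2 ++ x :: rev r1 by rewrite -(revK s') -e rev_cat rev_cons cat_rcons.
    have /allPn[z hz1 hz2] := hB _ nb _ _ (eq_ind _ (fun l => l \in t) hs' _ es').
    by apply/allPn; exists z; [rewrite -mem_rev|rewrite /= mem_rev].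
  - exists (rev s2), (rev s1); split; last by move=> z; rewrite !mem_rev => /s1w.
    by apply/mapP; exists (s1 ++ y :: s2) => //; rewrite rev_cat rev_cons cat_rcons.
  - by rewrite mem_rev.
  - by rewrite mem_rev.
  exists (rev u'), y'; rewrite mem_rev in h5; rewrite mem_rev in h6; split=> //.
  - by move=> z; rewrite mem_rev => /h2; rewrite mem_rev.
  - by move=> z hz; rewrite mem_rev; apply: h3; rewrite mem_rev.
  - by rewrite mem_rev.
by apply: (two x) => // ha; apply: none; exists x.
Qed.

Lemma content_full D t w : rule_system D t w ->
  (exists2 s, s \in t & {subset s <= w}) -> exists2 u, D u & u =i w.
Proof.
move=> rs [s0 hs0 s0w].
have [u [Du uw hu]] : exists u, [/\ D u, {subset u <= w} &
    forall s, s \in t -> {subset s <= w} -> {subset s <= u}].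
  pose L := [seq s <- t | all (mem w) s].
  have LD s : s \in L -> D s by rewrite mem_filter => /andP[_]; apply: rs_gen rs s.
  have Lw : {subset flatten L <= w}.
    by move=> z /flattenP[s]; rewrite mem_filter => /andP[/allP h _]; apply: h.
  have LL s : s \in t -> {subset s <= w} -> {subset s <= flatten L}.
    by move=> hs sw z hz; apply/flattenP; exists s => //; rewrite mem_filter hs andbT; apply/allP.
  (* Only products of an odd number of factors stay in [D], so [s0] is repeated when needed. *)
  case: (boolP (odd (size L))) => ho.
    by exists (flatten L); split=> //; apply: (closed_flatten (rs_closed rs) ho LD).
  exists (flatten (s0 :: L)); split.
  - apply: (closed_flatten (rs_closed rs)) => [//|s].
    by rewrite inE => /orP[/eqP->|/LD] //; apply: rs_gen rs _ hs0.
  - by move=> z; rewrite /= mem_cat => /orP[/s0w|/Lw].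
  by move=> s hs sw z hz; rewrite /= mem_cat (LL s hs sw z hz) orbT.
have [n] := ubnP (count (fun z => z \notin u) (undup w)).
elim: n u Du uw hu => // n IH u Du uw hu hn.
have [/allP wu|/allPn[x xw xu]] := boolP (all (mem u) w).
  by exists u => // z; apply/idP/idP => [/uw|/wu].
have [u' [y [Du' u'w uu' yu' [yw yu]]]] := content_step rs Du uw hu xw xu.
apply: (IH u') => //; first by move=> s hs sw z hz; apply/uu'/(hu s).
rewrite -ltnS; apply: leq_trans hn; rewrite ltnS.
have hsub : count (fun z => z \notin u') (undup w) + count (pred1 y) (undup w) <=
            count (fun z => z \notin u) (undup w).
  rewrite -count_predUI [X in _ + X](eq_count (a2 := pred0)); last first.
    by move=> z /=; case: eqP => [->|_]; rewrite ?yu' ?andbF.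
  rewrite count_pred0 addn0; apply: sub_count => z /= /orP[|/eqP->] //.
  by apply: contra => /uu'.
by apply: leq_trans hsub; rewrite count_uniq_mem ?undup_uniq // mem_undup yw addn1.
Qed.

(** * The orders of occurrences and the parities of [w] *)

Lemma prefix_order D t w u : rule_system D t w -> D u -> u =i w ->
  exists2 G, D G & G =i w /\ fo G = fo w.
Proof.
move=> rs Du uw; have cD := rs_closed rs.
have TTne : flatten t ++ flatten t != [::].
  rewrite cat_nil_neq orbb; have := rs_t rs; have := rs_gen rs.
  case: (t) => // s t' h _; have := closed_ne cD (h s (mem_head _ _)).
  by rewrite /= cat_nil_neq => ->.
set T := flatten t in TTne *.
suff: forall w1 w2, w = w1 ++ w2 ->
    exists a r, [/\ fo a = fo w1, D (a ++ r) & a ++ r =i w].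
  move/(_ w [::]); rewrite cats0 => /(_ erefl)[a [r [h1 h2 h3]]].
  exists (a ++ r) => //; split=> //; rewrite fo_cat_sub // => z hz.
  by rewrite -mem_fo h1 mem_fo -h3 mem_cat hz orbT.
elim/last_ind => [|w1 x IH] w2 ew; first by exists [::], u.
have [a [r [ha Dar arw]]] : exists a r, [/\ fo a = fo w1, D (a ++ r) & a ++ r =i w].
  by apply: (IH (x :: w2)); rewrite ew cat_rcons.
rewrite fo_rcons; case: ifP => hx; first by exists a, r.
have am : a =i w1 by move=> z; rewrite -mem_fo ha mem_fo.
have [v vE] : exists v, v = a ++ r by eexists.
rewrite -vE in Dar arw.
have vne : v != [::] := closed_ne cD Dar.
(* Letters of [w1] go to [a a], [x] to [x x], other letters of [w] to [Z], and letters outside [w]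
   to [T T]. [Z] begins with [r] because [r] may be read after [a]. If [a] is empty no letter goes
   to [A], but the value must still be nonempty. *)
pose A := if a is [::] then [:: x; x] else a ++ a.
pose Z := (r ++ a) ++ (r ++ a).
have Zm z : z \in Z = (z \in w) by rewrite mem_cat orbb mem_cat orbC -mem_cat -vE arw.
pose b1 z := (z \in w1) || (z == x).
pose b2 z := (z \in w) && ((z \in w1) || (z != x)).
pose f (c1 c2 : bool) := if c1 then if c2 then A else [:: x; x]
                         else if c2 then Z else T ++ T.
pose tau z := f (b1 z) (b2 z).
have xw : x \in w by rewrite ew mem_cat mem_rcons mem_head.
have w1w z : z \in w1 -> z \in w by move=> hz; rewrite ew mem_cat mem_rcons inE hz orbT.
have tau1 z : z \in w1 -> tau z = a ++ a.
  move=> hz; rewrite /tau /f /b1 /b2 hz (w1w z hz) /= /A.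
  by case: (a) (am z); rewrite hz.
have taux : tau x = [:: x; x] by rewrite /tau /f /b1 /b2 hx eqxx /= andbF.
have tauZ z : z \in w -> z \notin w1 -> z != x -> tau z = Z.
  by move=> zw zw1 zx; rewrite /tau /f /b1 /b2 (negbTE zw1) (negbTE zx) zw.
have tauO z : z \notin w -> tau z = T ++ T.
  move=> zw; rewrite /tau /f /b1 /b2 (negbTE zw) /=.
  have -> : z \in w1 = false by apply: contraNF zw => /w1w.
  by case: eqP => // ez; rewrite ez xw in zw.
have tauw z : z \in w -> {subset tau z <= w}.
  move=> zw; case: (boolP (z \in w1)) => hz1; first by rewrite tau1 // => c; rewrite mem_cat orbb am => /w1w.
  have [->|hzx] := eqVneq z x; first by rewrite taux => c; rewrite !inE orbb => /eqP->.
  by rewrite tauZ // => c; rewrite Zm.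
have taue z : same_parity (tau z) [::].
  case: (boolP (z \in w)) => zw; last by rewrite tauO //; apply: same_parity_double.
  case: (boolP (z \in w1)) => hz1; first by rewrite tau1 //; apply: same_parity_double.
  have [->|hzx] := eqVneq z x; first by rewrite taux; apply: (@same_parity_double [:: x]).
  by rewrite tauZ //; apply: same_parity_double.
have key : D (a ++ subst tau w ++ r ++ v ++ v).
  apply: (rs_rule rs) => [[] []|s hs] //.
  - by rewrite /f /A; case: (a) => // z l.
  - by rewrite /f /Z cat_nil_neq orbb; move: vne; rewrite vE !cat_nil_neq orbC.
  change (D (a ++ subst tau s ++ r ++ v ++ v)); set G := a ++ _.
  have vG : {subset v <= G} by move=> z hz; rewrite /G !mem_cat hz !orbT.
  have out y : y \in s -> y \notin w -> {subset T <= G}.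
    move=> hy hyw z hz; rewrite /G 2!mem_cat (@mem_subst tau s y z hy) ?orbT //.
    by rewrite tauO // mem_cat hz.
  have sT z : z \in s -> z \in T by move=> hz; apply/flattenP; exists s.
  have sG z : z \in s -> z \in G.
    by move=> hz; have [zw|/(out z hz)] := boolP (z \in w); [apply: vG; rewrite arw|apply; apply: sT].
  have gv P : lgood D G P v by apply: lgood_D.
  have gr P : {subset a <= P} -> lgood D G P r.
    by move=> aP; apply: (@lgood_mono _ _ a) => //; apply: (@lgood_catr _ _ [::]); rewrite -vE.
  have gT P : {subset T <= G} -> lgood D G P (T ++ T).
    move=> h; apply: lgood_cat; first by apply: lgood_flatten => //; apply: rs_gen rs.
    by apply: lgood_sub => z hz; rewrite mem_cat hz orbT.
  apply: (@criterion D G [:: v]) => //.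
  - by rewrite /G !cat_nil_neq vne !orbT.
  - apply: lgood_cat; first by apply: (@lgood_catl _ _ _ _ r); rewrite -vE.
    apply: lgood_cat; last first.
      apply: lgood_cat; first by apply: gr => z hz; rewrite !mem_cat hz.
      by apply: lgood_cat.
    apply: lgood_subst => s1 y s2 e.
    have hys : y \in s by rewrite e mem_cat mem_head orbT.
    have [hyw|hyw] := boolP (y \in w); last by rewrite tauO //; apply: gT; apply: out hyw.
    have [hy1|hy1] := boolP (y \in w1).
      by rewrite tau1 //; apply: lgood_sub => z; rewrite !mem_cat orbb => ->.
    have [eyx|hyx] := eqVneq y x; last first.
      rewrite tauZ //; apply: lgood_cat; last first.
        by apply: lgood_sub => z; rewrite !mem_cat => /orP[->|->]; rewrite ?orbT.
      apply: lgood_cat; first by apply: gr => z hz; rewrite mem_cat hz.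
      by apply: lgood_sub => z hz; rewrite !mem_cat hz.
    rewrite eyx taux.
    have gx : lgood D G (a ++ subst tau s1) [:: x].
      (* If only letters of [w1] precede [x], then [s] itself licenses [x]; otherwise the image of
         an earlier letter already contains [x]. *)
      have [/allP h|/allPn[z hz1 hz2]] := boolP (all (mem w1) s1).
        apply: (@lgood1 _ _ _ s1 x s2); first by rewrite -eyx -e; apply: rs_gen rs s hs.
          by move=> z /h hz; rewrite mem_cat am (hz : z \in w1).
        by move=> z hz; apply: sG; rewrite e mem_cat inE hz !orbT.
      apply: lgood_sub => c; rewrite inE mem_cat => /eqP->; apply/orP; right.
      apply: mem_subst hz1 _; have [zw|zw] := boolP (z \in w); last first.
        by rewrite tauO // mem_cat sT // -eyx.
      have [->|hzx] := eqVneq z x; first by rewrite taux mem_head.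
      by rewrite tauZ // Zm.
    by apply: (@lgood_cat _ _ _ [:: x] [:: x]) => //; apply: lgood_sub => z hz; rewrite mem_cat hz orbT.
  - apply: rgood_cat; last first.
      by apply: rgood_sub => z hz; rewrite !mem_cat vE !mem_cat hz !orbT.
    have rv P : {subset w <= P} -> rgood D G P r.
      by move=> wP; apply: rgood_sub => z hz; apply: wP; rewrite -arw vE mem_cat hz orbT.
    have gv' P : rgood D G P v by apply: rgood_D.
    have vw z : z \in w -> z \in v by rewrite arw.
    apply: rgood_cat.
      apply: rgood_cat; first by apply: rgood_cat.
      by apply: rv => z /vw hz; rewrite !mem_cat hz.
    apply: rgood_subst => s1 y s2 e.
    have hys : y \in s by rewrite e mem_cat mem_head orbT.
    have [hyw|hyw] := boolP (y \in w).
      by apply: rgood_sub => z /(tauw _ hyw) /vw hz; rewrite !mem_cat hz !orbT.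
    rewrite tauO //; apply: rgood_cat.
      by apply: rgood_flatten; [apply: rs_gen rs|apply: out hyw].
    by apply: rgood_sub => z hz; rewrite mem_cat hz.
  - by move=> z; rewrite inE => /eqP->.
  move=> z; rewrite /= cats0 /G !count_cat !oddD (subst_even (tau := tau)) //= addbb addbF.
  by rewrite vE count_cat oddD.
have [w2' ew'] : exists w2', w = w1 ++ x :: w2' by exists w2; rewrite ew cat_rcons.
(* In the image of [w], only copies of [a] come before the first [x]. *)
exists (a ++ subst tau w1 ++ [:: x]), (x :: subst tau w2' ++ r ++ v ++ v); split.
- rewrite catA cats1 fo_rcons fo_cat_sub; last first.
    by apply: subst_sub => y hy z; rewrite tau1 // mem_cat orbb.
  rewrite mem_cat am hx /= ha ifN //; apply: contraFN hx.
  by case/flatten_mapP => y hy; rewrite tau1 // mem_cat orbb am.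
- by move: key; rewrite {1}ew' subst_cat /= [subst tau (x :: _)]/(tau x ++ subst tau w2') taux -!catA.
move=> z; apply/idP/idP => [|zw]; last first.
  by rewrite !(mem_cat, inE) arw zw !orbT.
rewrite !(mem_cat, inE) -!orbA.
have aw c : c \in a -> c \in w by rewrite am; apply: w1w.
have rw c : c \in r -> c \in w by move=> hc; rewrite -arw vE mem_cat hc orbT.
have sw l : {subset l <= w} -> z \in subst tau l -> z \in w by move=> h; apply: subst_sub => y /h/tauw.
have sw1 := sw w1 w1w.
have sw2 : z \in subst tau w2' -> z \in w.
  by apply: sw => c hc; rewrite ew' mem_cat inE hc !orbT.
case/or4P => [/aw//|/sw1//|/eqP->//|/or4P[/eqP->//|/sw2//|/rw//|]].
by rewrite orbb arw.
Qed.

Lemma suffix_order D t w u : rule_system D t w -> D u -> u =i w ->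
  exists2 G, D G & G =i w /\ undup G = undup w.
Proof.
move=> rs Du uw.
have [||G DG [Gw fG]] := @prefix_order _ _ _ (rev u) (rule_system_rev rs).
- by rewrite /rev_pred revK.
- by move=> z; rewrite !mem_rev.
exists (rev G) => //; split=> [z|]; first by rewrite mem_rev Gw mem_rev.
by rewrite undup_rev fG fo_rev revK.
Qed.

Lemma subst_parity (Y : pred nat) d tau s :
  (forall z, same_parity (tau z) (if Y z then d else [::])) ->
  same_parity (subst tau s) (if odd (count Y s) then d else [::]).
Proof.
move=> h; elim: s => // y s IH z; rewrite /= count_cat !oddD h IH oddb.
by case: (Y y); case: (odd (count Y s)) => /=; rewrite ?addbb ?addbF ?addFb.
Qed.

(** A letter contributes the parity of [u ++ w] when it lies in [Y] and nothing otherwise. So a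
    framed image has the parity of [u] if its functional is [e], and of [w] if not. The first case
    is served by [u], the second by [H], and [w] itself is in the second. *)
Lemma parity_rule D t w u (Y : pred nat) (e : bool) : rule_system D t w -> D u -> u =i w ->
  (forall s, s \in t -> odd (count Y s) = e \/ ~~ all (mem w) s /\
     exists H, [/\ {subset H <= t}, odd (size H) & same_parity (flatten H) w]) ->
  odd (count Y w) <> e ->
  exists s, [/\ D s, {subset s <= w} & same_parity s w].
Proof.
move=> rs Du uw ht hw; have cD := rs_closed rs.
have une := closed_ne cD Du.
pose T := flatten t.
pose E (c : bool) := if c then u ++ w else u ++ u.
pose f (c1 c2 : bool) := (if c1 then u ++ u else T ++ T) ++ E c2.
pose tau z := f (z \in w) (Y z).
have Em c z : (z \in E c) = (z \in w).
  by rewrite /E; case: c; rewrite mem_cat !uw orbb.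
have Ene c : E c != [::] by rewrite /E; case: c; rewrite cat_nil_neq une.
have taup z : same_parity (tau z) (if Y z then u ++ w else [::]).
  move=> c; rewrite /tau /f /E count_cat oddD.
  have -> : odd (count_mem c (if z \in w then u ++ u else T ++ T)) = false.
    by case: ifP => _; rewrite same_parity_double.
  by case: (Y z) => //=; rewrite same_parity_double.
have par s : same_parity (u ++ subst tau s ++ E e)
    (if odd (count Y s) == e then u else w).
  move=> z; rewrite !count_cat !oddD (subst_parity _ taup) /E.
  case: (odd (count Y s)); case: e {ht hw} => /=; rewrite !count_cat !oddD;
  by case: (odd (count_mem z u)); case: (odd (count_mem z w)).
have key : D (u ++ subst tau w ++ E e ++ u ++ u).
  apply: (rs_rule rs) => [c1 c2|s hs]; first by rewrite /f cat_nil_neq Ene orbT.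
  change (D (u ++ subst tau s ++ E e ++ u ++ u)).
  have out y : y \in s -> y \notin w -> {subset T <= subst tau s}.
    move=> hy hyw z hz; apply: (mem_subst hy).
    by rewrite /tau /f (negbTE hyw) !mem_cat hz.
  pose G := u ++ (subst tau s ++ E e) ++ u ++ u.
  have TG y : y \in s -> y \notin w -> {subset T <= G}.
    by move=> hy hyw z /(out y hy hyw) hz; rewrite /G !mem_cat hz !orbT.
  have [H [ho hH hp]] : exists H, [/\ odd (size H), (forall x, x \in H -> D x /\ {subset x <= G})
      & same_parity (flatten H) (u ++ subst tau s ++ E e)].
    case: (ht s hs) => [hc|[/allPn[y hy hyw] [H [sH oH pH]]]].
      exists [:: u]; split=> // [x|z]; last by rewrite par hc eqxx /= cats0.
      by rewrite inE => /eqP->; split=> // z hz; rewrite /G mem_cat hz.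
    have [hc|hc] := eqVneq (odd (count Y s)) e.
      exists [:: u]; split=> // [x|z]; last by rewrite par hc eqxx /= cats0.
      by rewrite inE => /eqP->; split=> // z hz; rewrite /G mem_cat hz.
    exists H; split=> // [x /sH xt|z]; last by rewrite par (negbTE hc).
    split; first exact: rs_gen rs x xt.
    by move=> z hz; apply: (TG y hy hyw); apply/flattenP; exists x.
  rewrite (catA (subst tau s)); apply: (@sandwich D u _ H) => //; rewrite -/G.
  - apply: lgood_cat; last by apply: lgood_sub => z; rewrite Em -uw mem_cat => ->.
    apply: lgood_subst => s1 y s2 es; have hy : y \in s by rewrite es mem_cat mem_head orbT.
    rewrite /tau /f; apply: lgood_cat; last by apply: lgood_sub => z; rewrite Em -uw !mem_cat => ->.
    case: ifP => hyw; first by apply: lgood_sub => z; rewrite !mem_cat orbb => ->.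
    apply: lgood_cat; last by apply: lgood_sub => z hz; rewrite mem_cat hz orbT.
    by apply: lgood_flatten; [apply: rs_gen rs|apply: TG hy _; rewrite hyw].
  - apply: rgood_cat; first by apply: rgood_sub => z; rewrite Em -uw.
    apply: rgood_subst => s1 y s2 es; have hy : y \in s by rewrite es mem_cat mem_head orbT.
    rewrite /tau /f; apply: rgood_cat.
      by apply: rgood_sub => z; rewrite Em -uw !mem_cat => ->; rewrite !orbT.
    case: ifP => hyw; first by apply: rgood_sub => z; rewrite !mem_cat orbb => ->; rewrite !orbT.
    apply: rgood_cat; last by apply: rgood_sub => z hz; rewrite mem_cat hz.
    by apply: rgood_flatten; [apply: rs_gen rs|apply: TG hy _; rewrite hyw].
exists (u ++ subst tau w ++ E e ++ u ++ u); split=> //.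
  move=> z; rewrite !mem_cat Em uw !orbb => /or3P[//| |] //.
  by apply: subst_sub => y hy c; rewrite /tau /f hy !mem_cat Em uw !orbb.
move=> z; rewrite (catA (subst tau w)) (catA u) count_cat oddD par count_cat oddD addbb addbF.
by case: eqP.
Qed.

Lemma parity_word D t w u : rule_system D t w -> D u -> u =i w ->
  exists H, [/\ odd (size H), (forall s, s \in H -> D s /\ {subset s <= w}) &
    same_parity (flatten H) w].
Proof.
move=> rs Du uw.
suff: (exists H, [/\ odd (size H), (forall s, s \in H -> D s /\ {subset s <= w}) &
    same_parity (flatten H) w]) \/ exists s, [/\ D s, {subset s <= w} & same_parity s w].
  case=> // -[s [h1 h2 h3]]; exists [:: s]; split=> // [x|]; last by rewrite /= cats0.
  by rewrite inE => /eqP->.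
(* Separation is tried over the summands inside [w], then over all of [t]. If only the first attempt
   separates, [w] is an odd sum of words of [t], and this sum serves the summands not inside [w]. *)
case: (parity_sep_affine [seq s <- t | all (mem w) s] w) => [[H [sH oH pH]]|[Y [e [hY hYw]]]].
  left; exists H; split=> // s /sH; rewrite mem_filter => /andP[/allP h1 h2].
  by split; [apply: rs_gen rs s h2|move=> z /h1].
right; case: (parity_sep_affine t w) => [H0|[Y3 [e3 [h3 h3w]]]]; last first.
  by apply: (parity_rule rs Du uw (Y := Y3) (e := e3)) => // s hs; left; apply: h3.
have cY s : {subset s <= w} -> count (fun z => Y z && (z \in w)) s = count Y s.
  by move=> sw; apply: eq_in_count => z /sw ->; rewrite andbT.
apply: (parity_rule rs Du uw (Y := fun z => Y z && (z \in w)) (e := e)); last by rewrite cY.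
move=> s hs; case: (boolP (all (mem w) s)) => hsw; [left|by right].
by rewrite cY ?hY ?mem_filter ?hsw //; apply/allP.
Qed.

Lemma rule_system_inside D t w : rule_system D t w ->
  (exists2 s, s \in t & {subset s <= w}) -> D w.
Proof.
move=> rs hs; have [u Du uw] := content_full rs hs.
have [G1 D1 [m1 f1]] := prefix_order rs Du uw.
have [G2 D2 [m2 f2]] := suffix_order rs Du uw.
have [H [ho hH hp]] := parity_word rs Du uw.
apply: (@closed_assemble D w G1 G2 H (rs_closed rs) (rs_w rs)) => //.
  by move=> z; rewrite m1.
by move=> z; rewrite m2.
Qed.

(** * Inequalities in which every summand has a letter outside [w] *)

Lemma fo_congr_l a a' b : fo a = fo a' -> fo (a ++ b) = fo (a' ++ b).
Proof.
move=> h; rewrite !fo_cat h; congr (_ ++ _); apply: eq_filter => z.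
by rewrite -mem_fo h mem_fo.
Qed.

Lemma fo_congr_r a b b' : fo b = fo b' -> fo (a ++ b) = fo (a ++ b').
Proof. by move=> h; rewrite !fo_cat h. Qed.

Lemma undup_congr_l (a a' b : word) : undup a = undup a' -> undup (a ++ b) = undup (a' ++ b).
Proof. by move=> h; rewrite !undup_cat h. Qed.

Lemma undup_congr_r (a b b' : word) : undup b = undup b' -> undup (a ++ b) = undup (a ++ b').
Proof.
move=> h; rewrite !undup_cat h; congr (_ ++ _); apply: eq_filter => z.
by rewrite -mem_undup h mem_undup.
Qed.

Lemma fo_double g o : fo (g ++ o ++ o) = fo (g ++ o).
Proof. by apply: fo_congr_r; rewrite fo_cat_sub. Qed.

Lemma undup_double (g o : word) : undup ((o ++ o) ++ g) = undup (o ++ g).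
Proof. by apply: undup_congr_l; rewrite undup_cat_sub. Qed.

Lemma fo_subst2 (b : pred nat) tau g o s :
  (forall z, b z -> {subset tau z <= g}) ->
  (forall z, ~~ b z -> tau z =i o /\ fo (g ++ tau z) = fo (g ++ o)) ->
  fo (g ++ subst tau s) = fo (g ++ (if all b s then [::] else o)).
Proof.
move=> h1 h2; elim/last_ind: s => [//|s y IH].
rewrite -cats1 subst_cat all_cat /= andbT catA (fo_congr_l _ IH) /subst /= cats0 -catA.
case: (all b s) => /=.
  case: ifP => hy; last by case: (h2 y); rewrite ?hy.
  by rewrite cats0 fo_cat_sub //; apply: h1.
rewrite catA fo_cat_sub // => z hz; rewrite mem_cat.
have [hy|hy] := boolP (b y); first by rewrite (h1 y hy z hz).
by have [<- _] := h2 y hy; rewrite hz orbT.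
Qed.

Lemma undup_subst2 (b : pred nat) tau g o s :
  (forall z, b z -> {subset tau z <= g}) ->
  (forall z, ~~ b z -> tau z =i o /\ undup (tau z ++ g) = undup (o ++ g)) ->
  undup (subst tau s ++ g) = undup ((if all b s then [::] else o) ++ g).
Proof.
move=> h1 h2; apply: (can_inj (@revK _)); rewrite -!fo_rev !rev_cat rev_subst.
rewrite (@fo_subst2 b _ _ (rev o)) ?all_rev; first by case: ifP.
  by move=> z bz c; rewrite !mem_rev; apply: h1.
move=> z /h2[h3 h4]; split; first by move=> c; rewrite !mem_rev.
by rewrite -!rev_cat !fo_rev h4.
Qed.

Lemma similar_frame u X : {subset X <= u} -> same_parity X [::] ->
  similar u (u ++ X ++ u ++ u).
Proof.
move=> h1 h2; split.
- by rewrite fo_cat_sub // => z; rewrite !mem_cat orbb => /orP[/h1|].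
- rewrite !catA undup_cat_sub // => z; rewrite !mem_cat => /orP[/orP[|/h1]|] //.
by move=> z; rewrite !count_cat !oddD h2 addbb !addbF.
Qed.

Section Outside.
Variables (D : word -> Prop) (t : seq word) (w : word).
Hypothesis rs : rule_system D t w.
Hypothesis out : forall s, s \in t -> ~~ all (mem w) s.
Let cD := rs_closed rs.

(** Letters of [w] go to [g g], all others to [o o]. Every summand has a letter outside [w], so its
    framed image is similar to the given word, while that of [w] is similar to the word without
    [o o]. *)
Lemma delete_square p g o q : g != [::] -> o != [::] ->
  D (p ++ g ++ o ++ o ++ g ++ q) -> D (p ++ g ++ g ++ q).
Proof.
move=> ng no hD.
pose f (c1 c2 : bool) := if c1 then g ++ g else o ++ o.
pose tau z := f (z \in w) true.
have even z : same_parity (tau z) [::].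
  by rewrite /tau /f; case: ifP => _; apply: same_parity_double.
have foE s : fo (g ++ subst tau s) = fo (g ++ (if all (mem w) s then [::] else o)).
  apply: fo_subst2 => z zw; rewrite /tau /f.
    by rewrite (zw : z \in w) => c; rewrite mem_cat orbb.
  rewrite (negbTE (zw : z \notin w)) fo_double; split=> // c.
  by rewrite mem_cat orbb.
have undupE s : undup (subst tau s ++ g) = undup ((if all (mem w) s then [::] else o) ++ g).
  apply: undup_subst2 => z zw; rewrite /tau /f.
    by rewrite (zw : z \in w) => c; rewrite mem_cat orbb.
  rewrite (negbTE (zw : z \notin w)) undup_double; split=> // c.
  by rewrite mem_cat orbb.
have key : D ((p ++ g) ++ subst tau w ++ g ++ q).
  apply: (rs_rule rs (b1 := mem w) (b2 := xpredT) (f := f)) => [[] c|s hs].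
  - by rewrite /f cat_nil_neq ng.
  - by rewrite /f cat_nil_neq no.
  apply: (closed_sim cD _ _ hD); first by rewrite !cat_nil_neq ng orbT.
  split.
  - rewrite (_ : p ++ _ = p ++ (g ++ o ++ o) ++ g ++ q); last by rewrite -!catA.
    rewrite (_ : (p ++ g) ++ _ = p ++ (g ++ subst tau s) ++ g ++ q); last by rewrite -!catA.
    by apply/fo_congr_r/fo_congr_l; rewrite foE (negbTE (out hs)) fo_double.
  - rewrite [in LHS](_ : p ++ _ = (p ++ g) ++ ((o ++ o) ++ g) ++ q); last by rewrite -!catA.
    rewrite [in RHS](_ : (p ++ g) ++ _ = (p ++ g) ++ (subst tau s ++ g) ++ q); last by rewrite -!catA.
    by apply/undup_congr_r/undup_congr_l; rewrite undupE (negbTE (out hs)) undup_double.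
  move=> z; rewrite !count_cat !oddD (subst_even (s := s) (fun y _ => even y)) /=.
  by case: (odd (count_mem z p)); case: (odd (count_mem z g));
  case: (odd (count_mem z o)); case: (odd (count_mem z q)).
apply: (closed_sim cD _ _ key); first by rewrite !cat_nil_neq ng orbT.
have allw : all (mem w) w by apply/allP.
split.
- rewrite (_ : (p ++ g) ++ _ = p ++ (g ++ subst tau w) ++ g ++ q); last by rewrite -!catA.
  by apply/fo_congr_r/fo_congr_l; rewrite foE allw cats0.
- rewrite (_ : p ++ g ++ g ++ q = (p ++ g) ++ g ++ q); last by rewrite -!catA.
  rewrite (_ : (p ++ g) ++ subst _ _ ++ _ = (p ++ g) ++ (subst tau w ++ g) ++ q); last by rewrite -!catA.
  by apply/undup_congr_r/undup_congr_l; rewrite undupE allw.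
by move=> z; rewrite !count_cat !oddD (subst_even (s := w) (fun y _ => even y)) /= -addbA.
Qed.

Let sub_D s : s \in t -> D s.
Proof. exact: rs_gen rs s. Qed.

Let t_word : exists2 s, s \in t & D s.
Proof. by case: (t) (rs_t rs) sub_D => // s t' _ h; exists s; [|apply: h]; rewrite mem_head. Qed.

Lemma outside_letter z : z \in w -> exists2 s, D s & z \in s.
Proof.
move=> zw; have [s0 hs0 Ds0] := t_word.
have [zT|zT] := boolP (has (fun s => z \in s) t).
  by case/hasP: zT => s hs hz; exists s => //; apply: sub_D.
pose f (c1 c2 : bool) := if c1 then [:: z; z] else s0 ++ s0.
pose tau y := f (y == z) true.
have key : D (s0 ++ subst tau w ++ s0 ++ s0).
  apply: (rs_rule rs (b1 := pred1 z) (b2 := xpredT) (f := f)) => [[] c|s hs] //.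
    by rewrite /f cat_nil_neq (closed_ne cD Ds0).
  have ts y : y \in s -> tau y = s0 ++ s0.
    move=> hy; rewrite /tau /f; case: eqP => // ey.
    by move/hasPn: zT => /(_ s hs); rewrite -ey hy.
  apply: (closed_sim cD _ _ Ds0); first by rewrite cat_nil_neq (closed_ne cD Ds0).
  apply: similar_frame; first by apply: subst_sub => y hy c; rewrite [f _ _](ts y hy) mem_cat orbb.
  by apply: subst_even => y hy; rewrite [f _ _](ts y hy); apply: same_parity_double.
exists (s0 ++ subst tau w ++ s0 ++ s0) => //.
rewrite !mem_cat (@mem_subst tau w z z zw) ?orbT //.
by rewrite /tau /f eqxx mem_head.
Qed.

Lemma outside_content : exists2 V, D V & {subset w <= V}.
Proof.
suff: forall l : word, {subset l <= w} -> exists2 V, D V & {subset l <= V} by apply.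
elim=> [|z l IH] lw; first by have [s _ Ds] := t_word; exists s.
have [|V DV lV] := IH; first by move=> y hy; apply: lw; rewrite inE hy orbT.
have [s Ds zs] := outside_letter (lw _ (mem_head _ _)).
exists (s ++ V ++ V); first exact: closed3.
by move=> y; rewrite inE !mem_cat => /orP[/eqP->|/lV->]; rewrite ?zs ?orbT.
Qed.

(** If no summand begins with [x], send [x] to [x x] and all else to [V V]. The image of each
    summand followed by [V] is then similar to [V], while the image of [w] begins with [x]. *)
Lemma outside_head x w0 V : w = x :: w0 -> D V -> {subset w <= V} ->
  exists s, D (x :: s).
Proof.
move=> ew DV wV.
have [/hasP[s hs /eqP es]|hh] := boolP (has (fun s => ohead s == Some x) t).
  case: s hs es => [|y s] hs; first by [].
  by case=> ey; exists s; rewrite -ey; apply: sub_D.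
pose f (c1 c2 : bool) := if c1 then [:: x; x] else V ++ V.
pose tau y := f (y == x) true.
have xV : x \in V by apply: wV; rewrite ew mem_head.
have tauV y : {subset tau y <= V}.
  move=> c; rewrite /tau /f; case: ifP => _; last by rewrite mem_cat orbb.
  by rewrite !inE orbb => /eqP->.
have key : D ([::] ++ subst tau w ++ V).
  apply: (rs_rule rs (b1 := pred1 x) (b2 := xpredT) (f := f)) => [[] c|s hs] //.
    by rewrite /f cat_nil_neq (closed_ne cD DV).
  change (D (subst tau s ++ V)).
  have Vne := closed_ne cD DV.
  apply: (closed_sim cD _ _ DV); first by rewrite cat_nil_neq Vne orbT.
  have sV : {subset subst tau s <= V} by apply: subst_sub => y _; apply: tauV.
  split; last 1 first.
  - move=> z; rewrite count_cat oddD (subst_even (tau := tau)) // => y _.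
    rewrite /tau /f; case: ifP => _; last exact: same_parity_double.
    exact: (@same_parity_double [:: x]).
  - have := closed_ne cD (sub_D hs); move/hasPn: hh => /(_ s hs).
    case: s sV {hs} => // y s sV /= hy _.
    have ty : tau y = V ++ V by rewrite /tau /f; case: (y =P x) hy => // ->; rewrite eqxx.
    rewrite -[subst tau (y :: s)]/(tau y ++ subst tau s) ty -!catA fo_cat_sub // => z.
    by rewrite !mem_cat => /or3P[//|hz|//]; apply: sV; rewrite /subst /= mem_cat hz orbT.
  by rewrite undup_cat_sub.
have : subst tau w ++ V = x :: (x :: subst tau w0) ++ V.
  by rewrite ew /subst /= {1}/tau /f eqxx.
by move=> e; exists ((x :: subst tau w0) ++ V); rewrite -e.
Qed.

Lemma outside_parity V : D V -> {subset w <= V} ->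
  exists H, [/\ odd (size H), (forall s, s \in H -> D s) & same_parity (flatten H) w].
Proof.
move=> DV wV; have Vne := closed_ne cD DV.
case: (parity_sep_affine t w) => [[H [sH oH pH]]|[Y [e [hY hw]]]].
  by exists H; split=> // s /sH; apply: sub_D.
pose E (c : bool) := if c then V ++ w else V ++ V.
pose f (c1 c2 : bool) := E c1.
pose tau z := f (Y z) true.
have EV c : {subset E c <= V}.
  by move=> z; rewrite /E; case: c; rewrite mem_cat => /orP[|] // /wV.
have par s : same_parity (subst tau s ++ E e) (if odd (count Y s) == e then [::] else V ++ w).
  have h : same_parity (subst tau s) (if odd (count Y s) then V ++ w else [::]).
    apply: subst_parity => z; rewrite /tau /f /E.
    by case: (Y z) => //; apply: same_parity_double.
  move=> z; rewrite count_cat oddD h /E.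
  case: (odd (count Y s)); case: e {hY hw h} => /=; rewrite ?count_cat ?oddD ?addbb ?addbF //.
have key : D (V ++ subst tau w ++ E e ++ V ++ V).
  apply: (rs_rule rs (b1 := Y) (b2 := xpredT) (f := f)) => [c1 c2|s hs].
    by rewrite /f /E; case: c1; rewrite cat_nil_neq Vne.
  change (D (V ++ subst tau s ++ E e ++ V ++ V)).
  apply: (closed_sim cD _ _ DV); first by rewrite cat_nil_neq Vne.
  rewrite (catA (subst tau s)); apply: similar_frame.
    move=> z; rewrite mem_cat => /orP[|/EV//]; apply: subst_sub z => y _; exact: EV.
  by move=> z; rewrite par hY // eqxx.
exists [:: V ++ subst tau w ++ E e ++ V ++ V]; split=> // [s|].
  by rewrite inE => /eqP->.
move=> z; rewrite /= cats0 (catA (subst tau w)) !count_cat !oddD.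
have := par w z; rewrite count_cat oddD => ->.
by case: eqP hw => // _ _; rewrite count_cat oddD addbb addbF addbA addbb.
Qed.

End Outside.

Lemma rule_system_outside D t w : rule_system D t w ->
  (forall s, s \in t -> ~~ all (mem w) s) -> D w.
Proof.
move=> rs out; have cD := rs_closed rs.
have [V DV wV] := outside_content rs.
have [H [oH DH pH]] := outside_parity rs DV wV.
have [x [w0 ew]] : exists x w0, w = x :: w0 by case: (w) (rs_w rs) => // x w0 _; exists x, w0.
have [y [w1 ew1]] : exists y w1, w = rcons w1 y.
  by case/lastP: (w) (rs_w rs) => // w1 y _; exists y, w1.
have [h Dh] := outside_head rs ew DV wV.
have [k Dk] : exists k, D (rcons k y).
  have [|||k] := @outside_head _ _ _ (rule_system_rev rs) y (rev w1) (rev V).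
  - by rewrite ew1 rev_rcons.
  - by rewrite /rev_pred revK.
  - by move=> z; rewrite !mem_rev => /wV.
  by rewrite /rev_pred rev_cons => Dk; exists (rev k).
(* In the witness every factor outside [H] appears twice, so the parities are those of [H]. *)
have [U [DU pU wU [U0 eU0] [U1 eU1]]] : exists U, [/\ D U, same_parity U w,
    {subset w <= U}, exists U0, U = x :: U0 & exists U1, U = rcons U1 y].
  exists (flatten ([:: x :: h; V; V] ++ H ++ [:: x :: h; rcons k y; rcons k y])); split.
  - apply: closed_flatten => //; first by rewrite !size_cat !oddD oH.
    by move=> s; rewrite !mem_cat !inE => /or3P[/or3P[]/eqP->|/DH|/or3P[]/eqP->].
  - have F3 (a b c : word) : flatten [:: a; b; c] = a ++ b ++ c by rewrite /= cats0.
    move=> z; rewrite !flatten_cat !F3 !count_cat !oddD pH !addbb !addbF.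
    by rewrite addbC -addbA addbb addbF.
  - by move=> z /wV hz; apply/flattenP; exists V; rewrite ?inE ?eqxx ?orbT.
  - by eexists.
  exists (flatten ([:: x :: h; V; V] ++ H ++ [:: x :: h; rcons k y]) ++ k).
  by rewrite rcons_cat !flatten_cat /= !cats0 -!catA /= -!catA.
have xw : x \in w by rewrite ew mem_head.
have yw : y \in w by rewrite ew1 mem_rcons mem_head.
have Une : U != [::] by rewrite eU0.
have fxx : fo [:: x; x] = fo [:: x] := fo_double [::] [:: x].
have xU := wU _ xw; have yU := wU _ yw.
have aU : all (mem U) U by apply/allP.
have aw : all (mem U) w by apply/allP.
(* This word is similar to [U]: it begins with [x U], ends with [U y], and only [w] survives in
   parity. Deleting both squares [U U] leaves [x x w y y], which is similar to [w]. *)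
have D1 : D ([::] ++ [:: x] ++ U ++ U ++ [:: x] ++ w ++ [:: y] ++ U ++ U ++ [:: y]).
  apply: (closed_sim cD _ _ DU) => //; split.
  - rewrite -[fo ([::] ++ _)]/(fo (([:: x] ++ U) ++ (U ++ [:: x] ++ w ++ [:: y] ++ U ++ U ++ [:: y]))).
    rewrite fo_cat_sub => [|z hz]; last first.
      suff zU : z \in U by rewrite -[z \in _]/(z \in x :: U) inE zU orbT.
      by move: z hz; apply/allP; rewrite !all_cat /= aU aw xU yU.
    by rewrite eU0 -[[:: x] ++ _]/([:: x; x] ++ U0) (fo_congr_l (a := [:: x; x]) _ fxx).
  - rewrite (_ : _ ++ _ = ([:: x] ++ U ++ U ++ [:: x] ++ w ++ [:: y] ++ U) ++ (U ++ [:: y])); last first.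
      by rewrite /= -!catA /= -!catA.
    rewrite undup_cat_sub => [|z hz]; last first.
      suff zU : z \in U by rewrite mem_cat zU.
      by move: z hz; apply/allP; rewrite !all_cat /= aU aw xU yU.
    rewrite eU1 -cats1 -catA; apply: undup_congr_r.
    by rewrite /= mem_head.
  move=> z; rewrite !count_cat !oddD -(pU z) /= ?addn0 ?oddb ?oddD ?oddb.
  by case: (x == z); case: (y == z); case: (odd (count_mem z U)).
have D2 : D (([:: x; x] ++ w) ++ [:: y] ++ U ++ U ++ [:: y] ++ [::]).
  by have := delete_square rs out (isT : [:: x] != [::]) Une D1; rewrite /= -?catA.
have := delete_square rs out (isT : [:: y] != [::]) Une D2.
apply: (closed_sim cD (rs_w rs)); split.
- rewrite ew -!catA -[fo _]/(fo ([:: x; x] ++ x :: w0 ++ [:: y; y])).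
  rewrite (fo_congr_l _ fxx) -[fo _]/(fo ([:: x; x] ++ w0 ++ [:: y; y])) (fo_congr_l _ fxx).
  rewrite -[[:: x] ++ _]/((x :: w0) ++ [:: y; y]) -ew fo_cat_sub // => z.
  by rewrite !inE orbb => /eqP->.
- rewrite -catA cats0 undup_cat_sub => [|z]; last by rewrite !inE orbb mem_cat => /eqP->; rewrite xw.
  rewrite {1}ew1 -cats1 -!catA ew1 -cats1; apply: undup_congr_r => //.
  by rewrite /= !inE eqxx.
move=> z; rewrite !(count_cat, oddD) /= !oddb.
by case: (x == z); case: (y == z); case: (odd (count_mem z w)).
Qed.

Theorem rule_system_complete D t w : rule_system D t w -> D w.
Proof.
move=> rs; have [/hasP[s hs /allP sw]|/hasPn h] := boolP (has (all (mem w)) t).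
  by apply: rule_system_inside rs _; exists s.
exact: rule_system_outside rs h.
Qed.

(** * Finite bases *)

Fixpoint words (t : term) : seq word :=
  match t with
  | Var i => [:: [:: i]]
  | Add a b => words a ++ words b
  | Mul a b => [seq x ++ y | x <- words a, y <- words b]
  end.

Lemma words_ne t s : s \in words t -> s != [::].
Proof.
elim: t s => [i|a IHa b IHb|a IHa b IHb] s /=; first by rewrite inE => /eqP->.
  by rewrite mem_cat => /orP[/IHa|/IHb].
by case/allpairsP => -[x y] /= [/IHa hx _ ->]; rewrite cat_nil_neq hx.
Qed.

Lemma words_nil t : words t != [::].
Proof.
elim: t => [i|a IHa b IHb|a IHa b IHb] //=; first by rewrite cat_nil_neq IHa.
by case: (words a) (words b) IHa IHb => [|x X] [|y Y].
Qed.

Section Words.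
Variable S : algebra.
Hypothesis SrS : Sr 3 S.
Local Open Scope ai_scope.

Lemma words_le v t s : s \in words t -> ev v s <= eval S v t.
Proof.
elim: t s => [i|a IHa b IHb|a IHa b IHb] s /=.
- by rewrite inE => /eqP->; apply: saddx.
- rewrite mem_cat => /orP[/IHa|/IHb] h; apply: (sle_trans SrS h).
    exact: sle_addl.
  exact: sle_addr.
case/allpairsP => -[x y] /= [hx hy ->].
by rewrite ev_cat ?(words_ne hx) ?(words_ne hy) //; apply: smul_le; [|apply: IHa|apply: IHb].
Qed.

(** The additive context [F] carries the induction through products. *)
Lemma words_ge v t (F : S -> S) T : (forall x y, F (x + y) = F x + F y) ->
  (forall s, s \in words t -> F (ev v s) <= T) -> F (eval S v t) <= T.
Proof.
elim: t F => [i|a IHa b IHb|a IHa b IHb] F hF h /=.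
- by apply: (h [:: i]); rewrite mem_head.
- rewrite hF; apply/(sadd_le SrS); split.
    by apply: IHa => // s hs; apply: h; rewrite mem_cat hs.
  by apply: IHb => // s hs; apply: h; rewrite mem_cat hs orbT.
apply: (IHa (fun x => F (x * eval S v b))) => [x y|s hs]; first by rewrite smulDl.
apply: (IHb (fun x => F (ev v s * x))) => [x y|s' hs']; first by rewrite smulDr.
rewrite -ev_cat ?(words_ne hs) ?(words_ne hs') //; apply: h.
by apply/allpairsP; exists (s, s').
Qed.

(** The context [p _ q]; for lack of a unit, an empty side means no factor. *)
Definition plug v (p q : word) (x : S) : S :=
  let y := if q is [::] then x else x * ev v q in
  if p is [::] then y else ev v p * y.

Lemma plugD v p q x y : plug v p q (x + y) = plug v p q x + plug v p q y.
Proof. by rewrite /plug; case: p => [|z p]; case: q => [|z' q]; rewrite ?smulDl ?smulDr. Qed.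

Lemma plug_ev v p q s : s != [::] -> plug v p q (ev v s) = ev v (p ++ s ++ q).
Proof.
move=> hs; rewrite /plug; case: p => [|z p]; case: q => [|z' q];
by rewrite ?cats0 ?cat0s // !ev_cat ?cat_nil_neq ?hs.
Qed.

Lemma plug_le v p q x y : x <= y -> plug v p q x <= plug v p q y.
Proof. by move=> h; rewrite -plugD h. Qed.

Lemma ev_subst (v : nat -> S) tau s : s != [::] -> (forall z, tau z != [::]) ->
  ev v (subst tau s) = ev (fun z => ev v (tau z)) s.
Proof.
move=> hs ht; elim: s hs => // z [|z' s] IH _; first by rewrite /subst /= cats0.
rewrite -[subst _ _]/(tau z ++ subst tau (z' :: s)) ev_cat // ?IH //.
by rewrite -[subst _ _]/(tau z' ++ _) cat_nil_neq ht.
Qed.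

Lemma ev_map (v : nat -> S) (r : nat -> nat) s : s != [::] -> ev v (map r s) = ev (fun z => v (r z)) s.
Proof. by move=> hs; elim: s hs => // z [|z' s] IH _ //; rewrite (ev_cons _ _ (w := z' :: s)) // -IH. Qed.

(** Let [D] be the nonempty words with value below that of [t]. The assumed instances in four
    variables are its rules, so [rule_system_complete] puts [w] into [D]. *)
Lemma rule_system_ev v (t : term) (w : word) : w != [::] ->
  (forall (r : nat -> nat) (v' : nat -> S), (forall z, r z < 4)%N ->
     ev (fun z => v' (r z)) w <= eval S (fun z => v' (r z)) t) ->
  ev v w <= eval S v t.
Proof.
move=> hw hK; set T := eval S v t.
suff: rule_system (fun g => g != [::] /\ ev v g <= T) (words t) w.
  by case/rule_system_complete.
split=> //; last 1 first.
- move=> b1 b2 f p q hf tau hD.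
  (* The two bits are coded as a binary number below four, which [sg] decodes. *)
  pose r z := ((b1 z).*2 + b2 z)%N.
  pose sg k := f (1 < k)%N (odd k).
  have hr z : (r z < 4)%N by rewrite /r; case: (b1 z); case: (b2 z).
  have ht z : tau z = sg (r z) by rewrite /tau /sg /r; case: (b1 z); case: (b2 z).
  have tne z : tau z != [::] by apply: hf.
  have sne s : s != [::] -> subst tau s != [::].
    by case: s => // z s _; rewrite /subst /= cat_nil_neq tne.
  split; first by rewrite !cat_nil_neq sne ?orbT.
  have evs s : s != [::] -> ev v (subst tau s) = ev (fun z => ev v (sg (r z))) s.
    move=> hs; rewrite ev_subst // /tau; elim: s hs => // z [|z' s] IH _.
      by rewrite /= -ht.
    by rewrite !(ev_cons _ _ (w := z' :: s)) // IH // -ht.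
  rewrite -plug_ev ?sne //; apply: (@sle_trans S SrS (plug v p q (eval S (fun z => ev v (sg (r z))) t))).
    by apply: plug_le; rewrite evs //; apply: (hK r (fun k => ev v (sg k)) hr).
  apply: words_ge => [x y|s hs]; first exact: plugD.
  have ns := words_ne hs; rewrite -evs // plug_ev ?sne //.
  by have [] := hD s hs.
- split.
  + by move=> s [].
  + by move=> s s' ns' sim [ns h]; split=> //; rewrite -(ev_similar v SrS ns ns' sim).
  move=> p a b c q na nb nc [_ ha] [_ hb] [_ hc]; split; first by rewrite !cat_nil_neq na orbT.
  have -> : p ++ a ++ b ++ c ++ q = p ++ (a ++ b ++ c) ++ q by rewrite -!catA.
  rewrite -plug_ev // in ha; rewrite -plug_ev // in hb; rewrite -plug_ev // in hc.
  rewrite -plug_ev ?cat_nil_neq ?na // !ev_cat ?cat_nil_neq ?nb //.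
  apply: (@sle_trans S SrS (plug v p q (ev v a + ev v b + ev v c))).
    by apply: plug_le; apply: triple_le.
  by rewrite !plugD !(sadd_le SrS).
- by move=> s hs; split; [apply: words_ne hs|apply: words_le].
exact: words_nil.
Qed.
End Words.

(** * A finite list of candidate inequalities *)

Fixpoint tword (w : word) : term :=
  match w with
  | [::] => Var 0
  | z :: w' => if w' is [::] then Var z else Mul (Var z) (tword w')
  end.

Fixpoint tsum (L : seq word) : term :=
  match L with
  | [::] => Var 0
  | w :: L' => if L' is [::] then tword w else Add (tword w) (tsum L')
  end.

Lemma words_tword w : w != [::] -> words (tword w) = [:: w].
Proof.
elim: w => // z [|z' w] IH _ //.
by rewrite -[words _]/(allpairs cat [:: [:: z]] (words (tword (z' :: w)))) IH.
Qed.

Lemma words_tsum L : L != [::] -> (forall w, w \in L -> w != [::]) -> words (tsum L) = L.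
Proof.
elim: L => // w [|w' L] IH _ h; first by rewrite /= words_tword // h ?mem_head.
rewrite -[words _]/(words (tword w) ++ words (tsum (w' :: L))).
rewrite words_tword ?h ?mem_head // IH // => s hs; apply: h.
by rewrite inE hs orbT.
Qed.

Lemma eval_tword (S : algebra) v w : eval S v (tword w) = ev v w.
Proof. by elim: w => // z [|z' w] IH //; rewrite (ev_cons v z (w := z' :: w)) // -IH. Qed.

Fixpoint words_upto (n : nat) : seq word :=
  if n is n'.+1 then [::] :: [seq z :: s | z <- iota 0 4, s <- words_upto n'] else [:: [::]].

Lemma mem_words_upto n s : size s <= n -> all (fun z => z < 4) s -> s \in words_upto n.
Proof.
elim: n s => [|n IH] [|z s] // hs /andP[hz hall].
rewrite -[words_upto _]/([::] :: [seq z :: s | z <- iota 0 4, s <- words_upto n]).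
rewrite inE; apply/allpairsP; exists (z, s).
by rewrite mem_iota; split=> //; apply: IH.
Qed.

(** A normal form over four letters has three blocks of at most four letters, hence the bound 12.
    The lock keeps this large list from being computed. *)
Definition pool : seq word := locked [seq s <- words_upto 12 | s != [::]].

Lemma pool_ne s : s \in pool -> s != [::].
Proof. by rewrite /pool -lock mem_filter => /andP[]. Qed.

Lemma nform_pool s : s != [::] -> all (fun z => z < 4) s -> nform s \in pool.
Proof.
move=> ns /allP hs; rewrite /pool -lock mem_filter; apply/andP; split.
  by rewrite /nform cat_nil_neq -size_eq0 /fo size_rev; case: s ns hs => // z s _ _;
    rewrite size_eq0 (_ : undup _ != [::]) //; apply/eqP => e;
    have := mem_undup (rev (z :: s)) z; rewrite e mem_rev mem_head.
have sz (l : word) : uniq l -> {subset l <= s} -> size l <= 4.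
  move=> ul ls; rewrite -(size_iota 0 4); apply: uniq_leq_size => // z /ls/hs hz.
  by rewrite mem_iota.
apply: mem_words_upto.
  rewrite /nform !size_cat; have h1 : size (fo s) <= 4.
    by apply: sz; [apply: fo_uniq|move=> z; rewrite mem_fo].
  have h2 : size (undup s) <= 4 by apply: sz; [apply: undup_uniq|move=> z; rewrite mem_undup].
  have h3 : size [seq z <- undup s | odd (count_mem z s)] <= 4.
    by apply: leq_trans h2; rewrite size_filter count_size.
  by apply: (leq_add h1 (leq_add h3 h2)).
apply/allP => z; rewrite !mem_cat mem_fo mem_filter mem_undup => h; apply: hs.
by case/or3P: h => // /andP[].
Qed.

Lemma in_listP (T : eqType) (x : T) (l : seq T) : x \in l -> List.In x l.
Proof. by elim: l => // y l IH; rewrite inE => /orP[/eqP->|/IH]; [left|right]. Qed.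

Fixpoint sublists (T : Type) (l : seq T) : seq (seq T) :=
  if l is x :: l' then sublists l' ++ map (cons x) (sublists l') else [:: [::]].

Lemma filter_sublists (T : Type) (a : pred T) (l : seq T) : List.In (filter a l) (sublists l).
Proof.
elim: l => [|x l IH] /=; first by left.
apply/List.in_app_iff; case: (a x); [right|by left].
exact: List.in_map.
Qed.

Lemma filter_prop (T : Type) (P : T -> Prop) (l : seq T) :
  exists l', forall x, List.In x l' <-> List.In x l /\ P x.
Proof.
elim: l => [|y l [l' IH]]; first by exists nil => x; split=> // -[].
have [Py|nPy] := classic (P y).
  exists (y :: l') => x /=; rewrite IH; split; last by tauto.
  by case=> [<-|[]]; [split=> //; left|tauto].
exists l' => x /=; rewrite IH; split; first by tauto.
by case=> -[<-|] //.
Qed.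

Definition ineq_id (w : word) (L : seq word) : identity := (Add (tword w) (tsum L), tsum L).

Definition candidates : seq identity :=
  List.flat_map (fun w => List.map (ineq_id w) (sublists pool)) pool.

Fixpoint rename (r : nat -> nat) (t : term) : term :=
  match t with
  | Var i => Var (r i)
  | Add a b => Add (rename r a) (rename r b)
  | Mul a b => Mul (rename r a) (rename r b)
  end.

Lemma eval_rename (S : algebra) v r t : eval S v (rename r t) = eval S (fun z => v (r z)) t.
Proof. by elim: t => //= a -> b ->. Qed.

Lemma words_rename r t : words (rename r t) = map (map r) (words t).
Proof.
elim: t => [i|a IHa b IHb|a IHa b IHb] //=; first by rewrite IHa IHb map_cat.
rewrite IHa IHb allpairs_mapl allpairs_mapr map_allpairs.
by apply: eq_allpairs => x y; rewrite map_cat.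
Qed.

Section FiniteBasis.
Variable W : algebra -> Prop.
Hypothesis W_Sr : forall S, W S -> Sr 3 S.

(* The normal forms of words over four letters are finitely many, so up to
   equivalence there are only finitely many inequalities in four variables. *)
Lemma reduce_candidates (l : seq identity) (S : algebra) (w : word) (t : term) :
  (forall e, List.In e l <-> List.In e candidates /\ forall A, W A -> satisfies A e) ->
  Sr 3 S -> (forall e, List.In e l -> satisfies S e) ->
  w != [::] -> all (fun z => z < 4) w ->
  (forall s, s \in words t -> all (fun z => z < 4) s) ->
  (forall A v, W A -> Defs.add (ev v w) (eval A v t) = eval A v t) ->
  forall v, Defs.add (ev v w) (eval S v t) = eval S v t.
Proof.
move=> hl SrS hS nw w4 t4 hW v.
pose nf := map nform (words t).
pose L := [seq s <- pool | s \in nf].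
have inL s : s \in words t -> nform s \in L.
  move=> hs; rewrite mem_filter map_f //=; apply: nform_pool; first exact: words_ne hs.
  exact: t4.
have nL : L != [::].
  by case: (words t) (words_nil t) inL => // s s' _ /(_ s (mem_head _ _)); case: (L).
have neL s : s \in L -> s != [::] by rewrite mem_filter => /andP[_ /pool_ne].
have nfne s : s != [::] -> nform s != [::].
  move=> hs; rewrite /nform cat_nil_neq; apply/orP; left.
  apply/eqP => e; case: s hs e => // z s _ e.
  by have := mem_fo (z :: s) z; rewrite e mem_head.
have evE (A : algebra) (vA : nat -> A) s : Sr 3 A -> s != [::] -> ev vA (nform s) = ev vA s.
  move=> SrA hs; apply/esym/ev_similar => //; first exact: nfne.
  exact: nform_similar.
(* Passing to normal forms and forgetting repetitions preserves the value of the sum. *)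
have tE (A : algebra) (vA : nat -> A) : Sr 3 A -> eval A vA (tsum L) = eval A vA t.
  move=> SrA; apply: (sle_anti SrA).
    apply: (@words_ge A SrA vA _ id) => // s; rewrite words_tsum //.
    rewrite mem_filter => /andP[/mapP[s' hs' ->] _].
    by rewrite evE ?(words_ne hs') //; apply: words_le.
  apply: (@words_ge A SrA vA _ id) => // s hs.
  rewrite -evE ?(words_ne hs) //; apply: words_le => //.
  by rewrite words_tsum // inL.
have : List.In (ineq_id (nform w) L) l.
  apply/hl; split.
    apply/List.in_flat_map; exists (nform w); split; first by apply/in_listP/nform_pool.
    by apply: List.in_map; apply: filter_sublists.
  move=> A WA vA; have SrA := W_Sr WA.
  by rewrite /= eval_tword tE // evE //; apply: hW.
move/hS => /(_ v); rewrite /= eval_tword tE // evE //.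
Qed.

End FiniteBasis.

(** The basis consists of the laws of [Sr 3] and the candidates valid in [W]. An identity splits
    into two inequalities, these into single words below a sum, and these reduce to four
    variables. *)
Theorem Sr3_hereditarily_finitely_based : hereditarily_finitely_based (Sr 3).
Proof.
move=> W [E hE] W_Sr.
have [l0 hl0] := Sr_finitely_based 3.
have [l hl] := filter_prop (fun e => forall A, W A -> satisfies A e) candidates.
exists (l0 ++ l) => S; split.
  move=> WS e /List.in_app_iff[|/hl[_ h]]; last exact: h.
  by move: e; apply/hl0; apply: W_Sr.
move=> hS; have SrS : Sr 3 S by apply/hl0 => e he; apply: hS; apply/List.in_app_iff; left.
have hSl e : List.In e l -> satisfies S e by move=> he; apply: hS; apply/List.in_app_iff; right.
suff main a b : (forall A, W A -> satisfies A (a, b)) ->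
    forall v, Defs.add (eval S v a) (eval S v b) = eval S v b.
  apply/hE => -[a b] he v; apply: (sle_anti SrS).
    by apply: main => A /hE; apply.
  by apply: main => A /hE /(_ _ he) h vA; rewrite /= -[LHS]h.
move=> hab v; apply: (@words_ge S SrS v a id) => // w hw.
have nw := words_ne hw.
apply: rule_system_ev => // r v' hr.
rewrite -ev_map // -eval_rename.
apply: (reduce_candidates W_Sr hl) => //.
- by case: w nw {hw}.
- by apply/allP => z /mapP[y _ ->].
- by move=> s; rewrite words_rename => /mapP[s' _ ->]; apply/allP => z /mapP[y _ ->].
move=> A vA WA; rewrite ev_map // eval_rename.
rewrite -(hab A WA); apply: words_le => //; exact: W_Sr.
Qed.

Theorem Sr2_hereditarily_finitely_based : hereditarily_finitely_based (Sr 2).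
Proof.
move=> W hW W2; apply: Sr3_hereditarily_finitely_based => // S /W2[h1 h2]; split=> //.
by move=> v; have := h2 v; rewrite /= => h; rewrite !h.
Qed.

End SmallExponent.

(** * Exponents at least four *)

Module LargeExponent.

Import all_boot all_algebra zify ring ssrAC.
Set Implicit Arguments. Unset Strict Implicit. Unset Printing Implicit Defensive.
Import GRing.Theory.

(** For even [n] take a prime divisor of [n - 1], and for [n = 2k + 1] one of [k]; these numbers
    exceed one because [n > 3]. The binomial coefficient is the multiple of [f x.1 x.1] in the
    [n]-th power, see [gpow]. *)
Lemma exponent_prime n : 3 < n -> exists p, [/\ prime p, p %| n.-1 & p %| 'C(n, 2)].
Proof.
move=> n4; have [k en] : exists k, n = k.*2 \/ n = k.*2.+1.
  by exists n./2; rewrite -{1 3}(odd_double_half n); case: odd; [right|left].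
case: en => en.
  exists (pdiv n.-1); split; [by apply: pdiv_prime; lia|exact: pdiv_dvd|].
  rewrite bin2 en -doubleMl doubleK dvdn_mull // -en; exact: pdiv_dvd.
exists (pdiv k); split; first by apply: pdiv_prime; lia.
  by rewrite en /= -muln2 dvdn_mulr // pdiv_dvd.
by rewrite bin2 en /= -doubleMr doubleK dvdn_mull // pdiv_dvd.
Qed.

Fixpoint vbound (t : term) : nat :=
  match t with
  | Var i => i.+1
  | Add a b => maxn (vbound a) (vbound b)
  | Mul a b => maxn (vbound a) (vbound b)
  end.

Lemma eval_vbound (S : algebra) (v v' : nat -> S) t :
  (forall k, k < vbound t -> v k = v' k) -> eval S v t = eval S v' t.
Proof.
elim: t => [i|a IHa b IHb|a IHa b IHb] /= h; first exact: h.
  by rewrite IHa ?IHb // => k hk; apply: h; rewrite leq_max hk ?orbT.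
by rewrite IHa ?IHb // => k hk; apply: h; rewrite leq_max hk ?orbT.
Qed.

Lemma identities_bound (l : list identity) :
  exists m, forall e, List.In e l -> vbound e.1 <= m /\ vbound e.2 <= m.
Proof.
elim: l => [|e l [m hm]]; first by exists 0.
exists (maxn m (maxn (vbound e.1) (vbound e.2))) => e' /= [<-|/hm[h1 h2]].
  by rewrite !leq_max !leqnn !orbT.
by rewrite !leq_max h1 h2.
Qed.

Local Open Scope ring_scope.

(** * Flat extensions of groups of class 2 *)

Section FlatExtension.
Variables (V Z : zmodType) (f : V -> V -> Z).
Hypothesis fDl : forall x y z, f (x + y) z = f x z + f y z.
Hypothesis fDr : forall x y z, f x (y + z) = f x y + f x z.

Let f0l z : f 0 z = 0.
Proof. by apply: (addrI (f 0 z)); rewrite -fDl !addr0. Qed.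
Let f0r z : f z 0 = 0.
Proof. by apply: (addrI (f z 0)); rewrite -fDr !addr0. Qed.
Let fNl x z : f (- x) z = - f x z.
Proof. by apply: (addrI (f x z)); rewrite -fDl !subrr f0l. Qed.
Let fNr x z : f x (- z) = - f x z.
Proof. by apply: (addrI (f x z)); rewrite -fDr !subrr f0r. Qed.
Let fMl x z k : f (x *+ k) z = f x z *+ k.
Proof. by elim: k => [|k IH]; rewrite ?mulr0n ?f0l // !mulrS fDl IH. Qed.

(** The central extension of [V] by [Z] with cocycle [f]. *)
Definition gmul (x y : V * Z) : V * Z := (x.1 + y.1, x.2 + y.2 + f x.1 y.1).

Lemma gmulA x y z : gmul (gmul x y) z = gmul x (gmul y z).
Proof.
rewrite /gmul /= fDl fDr !addrA; congr (_, _).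
by rewrite [RHS](ACl (1*2*5*3*6*4)).
Qed.

Lemma gmulI x y z : gmul x y = gmul x z -> y = z.
Proof.
case: y z => y1 y2 [z1 z2] [/addrI -> /addIr /addrI ->] //.
Qed.

Lemma gmulIr x y z : gmul y x = gmul z x -> y = z.
Proof.
case: y z => y1 y2 [z1 z2] [/addIr -> /addIr /addIr ->] //.
Qed.

(** Flat order: group elements are pairwise incomparable below the top [None]. Cancellation in the
    group makes the product distribute. *)
Definition fadd (x y : option (V * Z)) := if x == y then x else None.
Definition fmul (x y : option (V * Z)) :=
  if x is Some a then if y is Some b then Some (gmul a b) else None else None.

Definition flat : algebra := @Algebra (option (V * Z)) fadd fmul (inhabits None).

Lemma flat_ai : is_ai_semiring flat.
Proof.
have inj1 a b c : (Some (gmul a b) == Some (gmul a c)) = (Some b == Some c).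
  by apply/eqP/eqP => [h|[->]] //; congr Some; apply: (@gmulI a); apply: Some_inj h.
have inj2 a b c : (Some (gmul b a) == Some (gmul c a)) = (Some b == Some c).
  by apply/eqP/eqP => [h|[->]] //; congr Some; apply: (@gmulIr a); apply: Some_inj h.
split; [|split; [|split; [|split; [|split]]]]; rewrite /= /fadd /fmul.
- move=> x y z; have [->|hxy] := eqVneq x y.
    by have [->|hyz] := eqVneq y z; rewrite ?eqxx ?(negbTE hyz) //; case: y hyz.
  have [eyz|hyz] := eqVneq y z; first by rewrite -eyz (negbTE hxy); case: y hxy {eyz}.
  by case: x z hxy hyz => [x|] [z|].
- by move=> x y; rewrite eq_sym; case: eqP => // ->.
- by move=> x; rewrite eqxx.
- by case=> [x|] [y|] [z|] //; rewrite gmulA.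
- by move=> [x|] [y|] [z|] //=; rewrite ?inj1 ?eqxx //; case: ifP.
by move=> [x|] [y|] [z|] //=; rewrite ?inj2 ?eqxx //; case: ifP.
Qed.

(** The central component of the commutator, whose other component is zero. *)
Definition gcomm (x y : V * Z) : Z := f x.1 y.1 - f y.1 x.1.

Lemma gpow x k : iter k (gmul^~ x) x = (x.1 *+ k.+1, x.2 *+ k.+1 + f x.1 x.1 *+ 'C(k.+1, 2)).
Proof.
elim: k => [|k IH]; first by rewrite /= !mulr1n addr0; case: x.
have gE a b : gmul (a, b) x = (a + x.1, b + x.2 + f a x.1) by [].
have hC : 'C(k.+2, 2) = ('C(k.+1, 2) + k.+1)%N by rewrite binS bin1.
rewrite iterS IH hC gE fMl; move: 'C(k.+1, 2) => c.
rewrite -mulrSr mulrnDr [x.2 *+ k.+2]mulrSr !addrA; congr (_, _).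
by rewrite [LHS](ACl (1*3*2*4)).
Qed.

Lemma eval_tpow (v : nat -> flat) t x n : eval flat v t = Some x ->
  eval flat v (tpow t n) = Some (iter (n - 1)%coq_nat (gmul^~ x) x).
Proof.
by rewrite /tpow => h; elim: (n - 1)%coq_nat => //= k IH; rewrite IH h.
Qed.

Section Torsion.
Variables (p n : nat).
Hypothesis (n4 : (3 < n)%N) (pn : (p %| n.-1)%N) (pC : (p %| 'C(n, 2))%N).
Hypothesis (Vp : forall x : V, x *+ p = 0) (Zp : forall x : Z, x *+ p = 0).

Let Vd x k : (p %| k)%N -> x *+ k = 0 :> V.
Proof. by case/dvdnP => j ->; rewrite mulnC mulrnA Vp mul0rn. Qed.
Let Zd x k : (p %| k)%N -> x *+ k = 0 :> Z.
Proof. by case/dvdnP => j ->; rewrite mulnC mulrnA Zp mul0rn. Qed.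

Let nE : n = n.-2.-1.+3. Proof. lia. Qed.

Lemma flat_Sr : Sr n flat.
Proof.
split; first exact: flat_ai.
move=> v; rewrite [LHS]/=; case e : (v 0) => [x|]; last first.
  have [k ->] : exists k, n = k.+2 by exists n.-2; lia.
  by rewrite /tpow /= e; case: (eval _ _ _).
rewrite (eval_tpow _ (x := x)) //= e gpow.
have -> : (n - 1)%coq_nat.+1 = n.-1.+1 by lia.
rewrite !mulrSr !Vd // !Zd //; last by rewrite prednK //; lia.
by rewrite !add0r addr0; case: x {e}.
Qed.

(** The group has exponent dividing [n - 1], so this power is the inverse. *)
Definition tinv (t : term) := tpow t (n - 2)%coq_nat.
Definition tcomm (s t : term) := Mul (Mul (tinv s) (tinv t)) (Mul s t).

Lemma eval_tinv (v : nat -> flat) t x : eval flat v t = Some x ->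
  eval flat v (tinv t) = Some (- x.1, - x.2 + f x.1 x.1).
Proof.
move=> h; rewrite (eval_tpow _ h) gpow; congr (Some (_, _)).
all: have -> : ((n - 2) - 1)%coq_nat.+1 = n.-2 by lia.
  by apply: (addrI x.1); rewrite -mulrS subrr; apply: Vd; move: pn; rewrite {1}nE {2}nE.
congr (_ + _).
  by apply: (addrI x.2); rewrite -mulrS subrr; apply: Zd; move: pn; rewrite {1}nE {2}nE.
(* Pascal's rule twice. Modulo [p] both ['C(n, 2)] and [n - 1] vanish, so ['C(n.-2, 2)] is congruent
   to [-(n - 2)], which is one. *)
have hC : ('C(n, 2) = 'C(n.-2, 2) + n.-2 + n.-1)%N.
  by rewrite nE (binS _.+2 1) (binS _.+1 1) !bin1.
have h1 : f x.1 x.1 *+ 'C(n.-2, 2) + f x.1 x.1 *+ n.-2 = 0.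
  have hz := Zd (f x.1 x.1) pC; rewrite hC 2!mulrnDr (Zd _ pn) addr0 in hz.
  exact: hz.
have h2 : f x.1 x.1 *+ n.-2 = - f x.1 x.1.
  by apply: (addrI (f x.1 x.1)); rewrite -mulrS subrr; apply: Zd; move: pn; rewrite {1}nE {2}nE.
by apply/eqP; rewrite -subr_eq0 -h2 h1.
Qed.

Lemma eval_tcomm (v : nat -> flat) s t x y :
  eval flat v s = Some x -> eval flat v t = Some y ->
  eval flat v (tcomm s t) = Some (0, gcomm x y).
Proof.
move=> hs ht; rewrite /tcomm -[LHS]/(fmul (fmul (eval flat v (tinv s)) (eval flat v (tinv t)))
   (fmul (eval flat v s) (eval flat v t))) (eval_tinv hs) (eval_tinv ht) hs ht /=.
congr Some; rewrite /gmul /gcomm /=; congr (_, _); first by rewrite addrACA !addNr addr0.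
rewrite !fDl !fDr !fNl !fNr opprK.
rewrite !addrA.
by rewrite [LHS](ACl ((6*1)*(7*3)*(2*9)*(4*12)*(8*10)*(5*11))) /= !subrr !add0r.
Qed.

Lemma fmul_Some x y a : fmul x y = Some a -> exists b c, x = Some b /\ y = Some c.
Proof. by case: x y => [b|] [c|] // _; exists b, c. Qed.

Lemma fadd_Some x y a : fadd x y = Some a -> x = Some a /\ y = Some a.
Proof. by rewrite /fadd; case: eqP => // <-. Qed.

Lemma tcomm_Some (v : nat -> flat) s t a : eval flat v (tcomm s t) = Some a ->
  exists x y, [/\ eval flat v s = Some x, eval flat v t = Some y & a = (0, gcomm x y)].
Proof.
move=> h; have [b [c [_ /fmul_Some[x [y [hs ht]]]]]] := fmul_Some h.
by exists x, y; split=> //; move: h; rewrite (eval_tcomm hs ht) => -[].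
Qed.

Lemma fmul_central z z' : fmul (Some (0, z)) (Some (0, z')) = Some (0, z + z').
Proof. by rewrite /= /gmul /= f0l addr0 addr0. Qed.

Lemma fadd_id x : fadd x x = x.
Proof. by rewrite /fadd eqxx. Qed.

(* The letters u, t, w_j, s_j are the variables 0, 1, 2j+2, 2j+3. *)
Definition tw j := Var (j.*2.+2).
Definition ts j := Var (j.*2.+3).

(** The signature has no unit, so [[u,u]] expresses it, here and as the base of [trels]. *)
Fixpoint tprod (i : nat) : term :=
  if i is j.+1 then Mul (tprod j) (tcomm (tw j) (ts j)) else tcomm (Var 0) (Var 0).

Fixpoint trels (i : nat) : term :=
  if i is j.+1
  then Add (trels j) (Add (tcomm (tw j) (Var 0)) (tcomm (tw j) (Var 1)))
  else tcomm (Var 0) (Var 0).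

(* In a flat extension of a group this expresses the implication: if all [w_j]
   commute with [u] and [t], and [u,t] [w_0,s_0] ... [w_(i-1),s_(i-1)] = 1, then
   [u,t] = 1. *)
Definition tlhs i := Add (Mul (tcomm (Var 0) (Var 1)) (tprod i)) (trels i).
Definition implication i : identity := (Add (tlhs i) (tcomm (Var 0) (Var 1)), tlhs i).

Lemma gcommxx x : gcomm x x = 0.
Proof. exact: subrr. Qed.

Lemma eval_tprod (v : nat -> flat) (u : V * Z) (w s : nat -> V * Z) i :
  v 0 = Some u -> (forall j, (j < i)%N -> v j.*2.+2 = Some (w j)) ->
  (forall j, (j < i)%N -> v j.*2.+3 = Some (s j)) ->
  eval flat v (tprod i) = Some (0, \sum_(j < i) gcomm (w j) (s j)).
Proof.
move=> h0; elim: i => [|i IH] hw hs.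
  by rewrite big_ord0 (eval_tcomm (x := u) (y := u)) // gcommxx.
rewrite big_ord_recr /= -fmul_central -IH => [|j hj|j hj]; last 2 first.
- by apply: hw; apply: ltnW.
- by apply: hs; apply: ltnW.
rewrite -[LHS]/(fmul _ _); congr fmul.
by apply: eval_tcomm; rewrite /= ?hw ?hs.
Qed.

Lemma implication_fails (v : nat -> flat) (u t : V * Z) (w s : nat -> V * Z) i :
  v 0 = Some u -> v 1 = Some t ->
  (forall j, (j < i)%N -> v j.*2.+2 = Some (w j)) ->
  (forall j, (j < i)%N -> v j.*2.+3 = Some (s j)) ->
  (forall j, (j < i)%N -> gcomm (w j) u = 0) -> (forall j, (j < i)%N -> gcomm (w j) t = 0) ->
  gcomm u t + \sum_(j < i) gcomm (w j) (s j) = 0 -> gcomm u t != 0 ->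
  ~ satisfies flat (implication i).
Proof.
move=> h0 h1 hw hs hwu hwt hsum hut /(_ v).
have hrels k : (k <= i)%N -> eval flat v (trels k) = Some (0, 0).
  elim: k => [_|k IH hk]; first by rewrite (eval_tcomm (x := u) (y := u)) // gcommxx.
  rewrite -[LHS]/(fadd (eval flat v (trels k)) (fadd (eval flat v (tcomm (tw k) (Var 0)))
    (eval flat v (tcomm (tw k) (Var 1))))) IH; last exact: ltnW.
  have -> : eval flat v (tcomm (tw k) (Var 0)) = Some (0, 0).
    by rewrite (@eval_tcomm v _ _ (w k) u) ?hwu //; apply: hw.
  have -> : eval flat v (tcomm (tw k) (Var 1)) = Some (0, 0).
    by rewrite (@eval_tcomm v _ _ (w k) t) ?hwt //; apply: hw.
  by rewrite !fadd_id.
have hlhs : eval flat v (tlhs i) = Some (0, 0).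
  rewrite -[LHS]/(fadd (fmul (eval flat v (tcomm (Var 0) (Var 1))) (eval flat v (tprod i)))
    (eval flat v (trels i))) hrels // (eval_tprod h0 hw hs).
  by rewrite (eval_tcomm (x := u) (y := t)) // fmul_central hsum fadd_id.
rewrite -[eval _ _ _]/(fadd (eval flat v (tlhs i)) (eval flat v (tcomm (Var 0) (Var 1)))).
rewrite -[X in _ = X]/(eval flat v (tlhs i)) hlhs (eval_tcomm (x := u) (y := t)) //.
by rewrite /fadd; case: eqP => // -[e]; rewrite -e eqxx in hut.
Qed.

(** If the left side is not [None], its summands all equal one group element, which the base [[u,u]]
    of [trels] makes the unit; so the premises hold. If it is [None], it absorbs the added term. *)
Lemma implication_holds i :
  (forall (u t : V * Z) (w s : nat -> V * Z),
    (forall j, (j < i)%N -> gcomm (w j) u = 0) -> (forall j, (j < i)%N -> gcomm (w j) t = 0) ->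
    gcomm u t + \sum_(j < i) gcomm (w j) (s j) = 0 -> gcomm u t = 0) ->
  satisfies flat (implication i).
Proof.
move=> himp v; rewrite -[LHS]/(fadd (eval flat v (tlhs i)) (eval flat v (tcomm (Var 0) (Var 1)))).
rewrite -[RHS]/(eval flat v (tlhs i)).
case e : (eval flat v (tlhs i)) => [g|]; last by rewrite /fadd; case: eqP => // <-.
have [e1 e2] := fadd_Some (e : fadd (fmul (eval flat v (tcomm (Var 0) (Var 1)))
   (eval flat v (tprod i))) (eval flat v (trels i)) = Some g).
have [c1 [c2 [hc1 hc2]]] := fmul_Some e1.
have [u [t [h0 h1 ec1]]] := tcomm_Some hc1.
have rels k : eval flat v (trels k) = Some g -> g = (0, 0) /\
    forall j, (j < k)%N -> exists2 wj, v j.*2.+2 = Some wj & gcomm wj u = 0 /\ gcomm wj t = 0.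
  elim: k => [|k IH] ek.
    by have [x [y [hx hy ->]]] := tcomm_Some ek; move: hy; rewrite hx => -[->]; rewrite gcommxx.
  have [/IH[eg hk] ek2] := fadd_Some (ek : fadd _ (fadd _ _) = _).
  split=> // j; rewrite ltnS leq_eqVlt => /orP[/eqP->|/hk//].
  have [/tcomm_Some[x [y [hx hy exy]]] /tcomm_Some[x' [y' [hx' hy' exy']]]] := fadd_Some ek2.
  exists x => //; move: hy hy' hx'; rewrite h0 h1 hx => -[ey] [ey'] [ex'].
  by move: exy exy'; rewrite -ey -ey' -ex' eg => -[<-] [<-].
have [eg hw] := rels i e2.
have hs k : (exists a, eval flat v (tprod k) = Some a) ->
    forall j, (j < k)%N -> exists s, v j.*2.+3 = Some s.
  elim: k => // k IH [a ek] j; have [b [c [eb ec]]] := fmul_Some (ek : fmul _ _ = _).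
  rewrite ltnS leq_eqVlt => /orP[/eqP->|]; last by apply: IH; exists b.
  by have [x [y [_ hy _]]] := tcomm_Some ec; exists y.
have {}hs := hs i (ex_intro _ _ hc2).
pose get k := if v k is Some x then x else 0.
have gw j : (j < i)%N -> v j.*2.+2 = Some (get j.*2.+2) by rewrite /get => /hw[x ->].
have gs j : (j < i)%N -> v j.*2.+3 = Some (get j.*2.+3) by rewrite /get => /hs[x ->].
have hut : gcomm u t = 0.
  apply: (himp u t (fun j => get j.*2.+2) (fun j => get j.*2.+3)).
  - by move=> j hj; have [x hx [hxu _]] := hw j hj; rewrite /get hx.
  - by move=> j hj; have [x hx [_ hxt]] := hw j hj; rewrite /get hx.
  move: e1; rewrite hc1 (eval_tprod h0 gw gs) ec1 fmul_central eg.
  by case.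
by rewrite (eval_tcomm h0 h1) hut eg fadd_id.
Qed.

End Torsion.
End FlatExtension.

(** * Heisenberg groups *)

Section Determinant.
Variable F : fieldType.
Let det2 (x y : F * F) := x.1 * y.2 - x.2 * y.1.

(** If [det2 u t] were nonzero, Cramer's rule would make every [w j] zero; the sum would vanish and
    leave [det2 u t = 0]. *)
Lemma det2_implication i (u t : F * F) (w s : nat -> F * F) :
  (forall j, (j < i)%N -> det2 (w j) u = 0) -> (forall j, (j < i)%N -> det2 (w j) t = 0) ->
  det2 u t + \sum_(j < i) det2 (w j) (s j) = 0 -> det2 u t = 0.
Proof.
move=> hu ht hsum; apply/eqP/negP => /negP hut.
move: hsum; rewrite big1 ?addr0 => [e|j _]; first by rewrite e eqxx in hut.
have w0 : (w j).1 = 0 /\ (w j).2 = 0.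
  have {}hu := hu j (ltn_ord j); have {}ht := ht j (ltn_ord j).
  split; apply: (mulIf hut); rewrite mul0r; move: hu ht; rewrite /det2 => hu ht.
    transitivity (u.1 * ((w j).1 * t.2 - (w j).2 * t.1) - t.1 * ((w j).1 * u.2 - (w j).2 * u.1)); first by ring.
    by rewrite hu ht !mulr0 subr0.
  transitivity (u.2 * ((w j).1 * t.2 - (w j).2 * t.1) - t.2 * ((w j).1 * u.2 - (w j).2 * u.1)); first by ring.
  by rewrite hu ht !mulr0 subr0.
by rewrite /det2; case: w0 => -> ->; rewrite !mul0r subr0.
Qed.
End Determinant.

Section Heisenberg.
Variables (F : fieldType) (r N : nat) (B : 'M[F]_(r, N)).

Notation V := ('rV[F]_r * 'rV[F]_N * (F * F))%type.
Notation Z := 'M[F]_N.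

(** Chosen so that a commutator is [mpart], controlled by the row space of [B], minus the scalar
    matrix of the determinant [dpart]. *)
Definition hform (x y : V) : Z :=
  (x.1.1 *m B)^T *m y.1.2 - (x.2.1 * y.2.2)%:M.

Lemma hformDl x y z : hform (x + y) z = hform x z + hform y z.
Proof.
by rewrite /hform /= mulmxDl linearD /= mulmxDl mulrDl raddfD /= opprD addrACA.
Qed.

Lemma hformDr x y z : hform x (y + z) = hform x y + hform x z.
Proof. by rewrite /hform /= mulmxDr mulrDr raddfD /= opprD addrACA. Qed.

Definition heis : algebra := flat hform.

Let mpart (x y : V) : Z := (x.1.1 *m B)^T *m y.1.2 - (y.1.1 *m B)^T *m x.1.2.
Let dpart (x y : V) : F := x.2.1 * y.2.2 - x.2.2 * y.2.1.

Lemma gcomm_heis x y : gcomm hform x y = mpart x.1 y.1 - (dpart x.1 y.1)%:M.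
Proof.
have sB (a b : F) : (a - b)%:M = a%:M - b%:M :> Z by rewrite raddfB.
rewrite /gcomm /hform /mpart /dpart [x.1.2.2 * _]mulrC sB !opprB !addrA.
by rewrite [RHS](ACl (1*4*3*2)).
Qed.

Lemma mpart_sub x y : ((mpart x y)^T <= B)%MS.
Proof.
rewrite /mpart linearB /= !trmx_mul !trmxK !mulmxA; apply: addmx_sub; last rewrite eqmx_opp;
by apply: submxMl.
Qed.

(** Once scalar and remaining parts are separated, [det2_implication] applies to [dpart] and to each
    matrix entry of [mpart]. *)
Lemma heis_implication i : (r < N)%N -> forall (u t : V * Z) (w s : nat -> V * Z),
    (forall j, (j < i)%N -> gcomm hform (w j) u = 0) ->
    (forall j, (j < i)%N -> gcomm hform (w j) t = 0) ->
    gcomm hform u t + \sum_(j < i) gcomm hform (w j) (s j) = 0 -> gcomm hform u t = 0.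
Proof.
move=> rN u t w s hu ht hsum.
(* the multiple of the identity has full rank, while the other part has rank at most [r] *)
have split0 (A : Z) (c : F) : (A^T <= B)%MS -> A - c%:M = 0 -> A = 0 /\ c = 0.
  move=> AB /subr0_eq eA; suff c0 : c = 0 by split=> //; rewrite eA c0 raddf0.
  apply/eqP/negP => /negP c0; move: AB; rewrite eA tr_scalar_mx => /mxrankS.
  rewrite -scalemx1 eqmx_scale // mxrank1 leqNgt => /negP; apply.
  exact: leq_ltn_trans (rank_leq_row _) rN.
have hu' j : (j < i)%N -> mpart (w j).1 u.1 = 0 /\ dpart (w j).1 u.1 = 0.
  by move/hu; rewrite gcomm_heis => /split0; apply; apply: mpart_sub.
have ht' j : (j < i)%N -> mpart (w j).1 t.1 = 0 /\ dpart (w j).1 t.1 = 0.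
  by move/ht; rewrite gcomm_heis => /split0; apply; apply: mpart_sub.
have [hm hd] : mpart u.1 t.1 + \sum_(j < i) mpart (w j).1 (s j).1 = 0 /\
               dpart u.1 t.1 + \sum_(j < i) dpart (w j).1 (s j).1 = 0.
  apply: split0.
    rewrite linearD /= linear_sum /=; apply: addmx_sub; first exact: mpart_sub.
    by apply: summx_sub => j _; apply: mpart_sub.
  rewrite -[RHS]hsum gcomm_heis; under [in RHS]eq_bigr do rewrite gcomm_heis.
  by rewrite [in RHS]sumrB raddfD opprD addrACA raddf_sum.
have d0 : dpart u.1 t.1 = 0.
  apply: (@det2_implication F i u.1.2 t.1.2 (fun j => (w j).1.2) (fun j => (s j).1.2)) => //.
    by move=> j /hu'[].
  by move=> j /ht'[].
suff m0 : mpart u.1 t.1 = 0 by rewrite gcomm_heis m0 d0 raddf0 subr0.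
apply/matrixP => k l; rewrite [RHS]mxE.
have mE (x y : V) : mpart x y k l =
    (x.1.1 *m B) ord0 k * y.1.2 ord0 l - x.1.2 ord0 l * (y.1.1 *m B) ord0 k.
  by rewrite [x.1.2 _ _ * _]mulrC /mpart !mxE /= !big_ord1 !mxE.
pose c (x : V) := ((x.1.1 *m B) ord0 k, x.1.2 ord0 l).
rewrite mE.
apply: (@det2_implication F i (c u.1) (c t.1) (fun j => c (w j).1) (fun j => c (s j).1)) => [j /hu'[h _]|j /ht'[h _]|].
- by rewrite /c /= -mE h mxE.
- by rewrite /c /= -mE h mxE.
have hkl := congr1 (fun A : Z => A k l) hm.
rewrite [RHS]mxE mxE summxE mE in hkl; rewrite -[RHS]hkl; congr (_ + _).
by apply: eq_bigr => j _; rewrite mE.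
Qed.

End Heisenberg.

(** * Embedding into the Heisenberg group of the identity matrix *)

Section Embedding.
Variables (F : fieldType) (r N : nat) (B : 'M[F]_(r, N)).
Hypothesis Bfree : row_free B.

Definition embed (x : 'rV[F]_r * 'rV[F]_N * (F * F) * 'M[F]_N) :
    'rV[F]_N * 'rV[F]_N * (F * F) * 'M[F]_N :=
  ((x.1.1.1 *m B, x.1.1.2, x.1.2), x.2).

Lemma embed_inj : injective embed.
Proof.
move=> [[[a b] c] d] [[[a' b'] c'] d'] [h -> -> ->].
by have := row_free_inj Bfree h => ->.
Qed.

Lemma embedM x y : embed (gmul (hform B) x y) = gmul (hform 1%:M) (embed x) (embed y).
Proof.
by rewrite /embed /gmul /hform /= mulmxDl !mulmx1.
Qed.

Lemma eval_embed (v : nat -> heis B) t :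
  eval (heis 1%:M) (fun k => omap embed (v k)) t = omap embed (eval (heis B) v t).
Proof.
elim: t => [i|a IHa b IHb|a IHa b IHb] //.
  rewrite -[LHS]/(fadd (eval (heis 1%:M) _ a) (eval (heis 1%:M) _ b)) IHa IHb.
  rewrite -[eval (heis B) v (Add a b)]/(fadd (eval (heis B) v a) (eval (heis B) v b)) /fadd.
  have inj : injective (omap embed) by exact: inj_omap embed_inj.
  by rewrite (inj_eq inj); case: eqP.
rewrite -[LHS]/(fmul _ (eval (heis 1%:M) _ a) (eval (heis 1%:M) _ b)) IHa IHb.
rewrite -[eval (heis B) v (Mul a b)]/(fmul _ (eval (heis B) v a) (eval (heis B) v b)).
by case: (eval (heis B) v a) (eval (heis B) v b) => [x|] [y|] //=; rewrite embedM.
Qed.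

End Embedding.

(** * A subvariety without a finite basis *)

Section NonFinitelyBased.
Variables (n p : nat).
Hypothesis n4 : (3 < n)%N.
Hypothesis pp : prime p.
Hypothesis pn : (p %| n.-1)%N.
Hypothesis pC : (p %| 'C(n, 2))%N.
Let F : fieldType := 'F_p.

Let Fp (x : F) : x *+ p = 0.
Proof. by rewrite -mulr_natr pchar_Fp_0 ?mulr0. Qed.

Let Mp r N (x : 'M[F]_(r, N)) : x *+ p = 0.
Proof. by apply/matrixP => i j; rewrite mulmxnE mxE Fp. Qed.

Let pairMn (A C : zmodType) (x : A * C) k : x *+ k = (x.1 *+ k, x.2 *+ k).
Proof. by elim: k => [|k IH]; rewrite ?mulr0n // !mulrS IH. Qed.

Let Vp r N (x : 'rV[F]_r * 'rV[F]_N * (F * F)) : x *+ p = 0.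
Proof. by rewrite !pairMn /= !Mp !Fp. Qed.

Lemma heis_Sr r N (B : 'M[F]_(r, N)) : Sr n (heis B).
Proof.
apply: (@flat_Sr _ _ (hform B) (hformDl B) (hformDr B) p n) => //.
- exact: Vp.
exact: Mp.
Qed.

Lemma heis_satisfies r N (B : 'M[F]_(r, N)) i : (r < N)%N ->
  satisfies (heis B) (implication n i).
Proof.
move=> rN; apply: (@implication_holds _ _ (hform B) (hformDl B) (hformDr B) p n) => //.
- exact: Vp.
- exact: Mp.
exact: heis_implication.
Qed.

(** Here [[u,t]] is minus the identity matrix and [[w_j,s_j]] is the [j]-th diagonal matrix unit, so
    the commutators sum to zero although [[u,t]] is nonzero. *)
Lemma heis_not_satisfies N : ~ satisfies (heis (1%:M : 'M[F]_N.+1)) (implication n N.+1).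
Proof.
pose e (j : nat) : 'rV[F]_N.+1 := delta_mx ord0 (inord j).
pose u : 'rV[F]_N.+1 * 'rV[F]_N.+1 * (F * F) * 'M[F]_N.+1 := (0, 0, (1, 0), 0).
pose t : 'rV[F]_N.+1 * 'rV[F]_N.+1 * (F * F) * 'M[F]_N.+1 := (0, 0, (0, 1), 0).
pose w j : 'rV[F]_N.+1 * 'rV[F]_N.+1 * (F * F) * 'M[F]_N.+1 := (e j, 0, (0, 0), 0).
pose s j : 'rV[F]_N.+1 * 'rV[F]_N.+1 * (F * F) * 'M[F]_N.+1 := (0, e j, (0, 0), 0).
(* The variables [2j + 2] and [2j + 3] halve to [j + 1], hence the predecessor. *)
pose v k : heis (1%:M : 'M[F]_N.+1) :=
  if k == 0 then Some u else if k == 1 then Some t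
  else if odd k then Some (s (k./2.-1)) else Some (w (k./2.-1)).
have K x y : gcomm (hform (1%:M : 'M[F]_N.+1)) x y =
    x.1.1.1^T *m y.1.1.2 - y.1.1.1^T *m x.1.1.2 - (x.1.2.1 * y.1.2.2 - x.1.2.2 * y.1.2.1)%:M.
  by rewrite gcomm_heis !mulmx1.
have scal0 : (0 : F)%:M = 0 :> 'M[F]_N.+1 by rewrite raddf0.
apply: (@implication_fails _ _ (hform 1%:M) (hformDl _) (hformDr _) p n n4 pn pC
  (@Vp _ _) (@Mp _ _) v u t w s) => //.
- by move=> j _; rewrite /v /= odd_double /= doubleK.
- by move=> j _; rewrite /v /= odd_double /= uphalf_double.
- by move=> j _; rewrite K /= trmx0 !(mulmx0, mul0mx, mulr0, mul0r, subr0) scal0 subr0.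
- by move=> j _; rewrite K /= trmx0 !(mulmx0, mul0mx, mulr0, mul0r, subr0) scal0 subr0.
- rewrite K /= trmx0 !(mulmx0, mul0mx, mulr0, mul0r, subr0, mulr1) sub0r.
  rewrite (eq_bigr (fun j : 'I_N.+1 => delta_mx j j)) => [|j _].
    by rewrite -mx1_sum_delta addNr.
  rewrite K /= trmx0 !(mulmx0, mul0mx, mulr0, mul0r, subr0) scal0 subr0.
  by rewrite /e inord_val trmx_delta mul_delta_mx.
rewrite K /= trmx0 !(mulmx0, mul0mx, mulr0, mul0r, subr0, mulr1) sub0r oppr_eq0.
exact: matrix_nonzero1.
Qed.

Theorem Sr_not_hereditarily_finitely_based : ~ hereditarily_finitely_based (Sr n).
Proof.
pose W S := Sr n S /\ forall i, satisfies S (implication n i).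
have W_variety : is_variety W.
  have [E hE] := Sr_variety n.
  exists (fun e => E e \/ exists i, e = implication n i) => S; split.
    by move=> [/hE h1 h2] e [/h1//|[i ->]].
  by move=> h; split=> [|i]; [apply/hE => e he; apply: h; left|apply: h; right; exists i].
move/(_ W W_variety (fun S => @proj1 _ _)) => [l hl].
(* A basis in the variables below [m] cannot exclude the group of the identity matrix of size
   [m + 1], which violates one of the implications. *)
have [m hm] := identities_bound l.
apply: (@heis_not_satisfies m).
suff [_ h] : W (heis (1%:M : 'M[F]_m.+1)) by apply: h.
apply/hl => e he v; have [hm1 hm2] := hm e he.
(* The first coordinates of the [m] relevant values, with zero for [None], span a space of dimension
   at most [m]. With [B] a basis of it, the valuation factors through [heis B], which lies in
   [W]. *)
pose vec (x : option ('rV[F]_m.+1 * 'rV[F]_m.+1 * (F * F) * 'M[F]_m.+1)) : 'rV[F]_m.+1 :=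
  if x is Some y then y.1.1.1 else 0.
pose A : 'M[F]_(m, m.+1) := \matrix_(i < m) vec (v i).
pose B := row_base A.
have rm : (\rank A < m.+1)%N by rewrite ltnS rank_leq_row.
have WB : W (heis B) by split=> [|i]; [apply: heis_Sr|apply: heis_satisfies].
pose v' k : heis B := if (k < m)%N then
   if v k is Some y then Some ((y.1.1.1 *m pinvmx B, y.1.1.2, y.1.2), y.2) else None else None.
have vE k : (k < m)%N -> v k = omap (embed B) (v' k).
  move=> hk; rewrite /v' hk; case ev : (v k) => [[[[a b] c] d]|] //=.
  rewrite /embed /= mulmxKpV // /B eq_row_base.
  have -> : a = row (Ordinal hk) A by rewrite rowK /= ev.
  exact: row_sub.
have Bfree : row_free B := row_base_free A.
have evE t : (vbound t <= m)%N -> eval (heis 1%:M) v t = omap (embed B) (eval (heis B) v' t).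
  move=> ht; rewrite -eval_embed //; apply: eval_vbound => k hk.
  by apply: vE; apply: leq_trans hk ht.
by rewrite !evE //; have /hl/(_ e he v') -> := WB.
Qed.

End NonFinitelyBased.

Theorem not_hereditarily_finitely_based (n : nat) : (4 <= n)%coq_nat ->
  ~ hereditarily_finitely_based (Sr n).
Proof.
move/leP => n4; have [p [pp pn pC]] := exponent_prime n4.
exact: Sr_not_hereditarily_finitely_based n4 pp pn pC.
Qed.

End LargeExponent.

From Stdlib Require Import List Arith Lia.

Theorem theorem3p4 (n : nat) (hn : 1 < n) :
  hereditarily_finitely_based (Sr n) <-> n < 4.
Proof.
split.
- intros h; destruct (Nat.lt_ge_cases n 4) as [h4|h4]; [exact h4|].
  exfalso; exact (LargeExponent.not_hereditarily_finitely_based h4 h).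
- intros h4; assert (n = 2 \/ n = 3) as [->| ->] by lia.
  + exact SmallExponent.Sr2_hereditarily_finitely_based.
  + exact SmallExponent.Sr3_hereditarily_finitely_based.
Qed.
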